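(* Let $E$ and $F$ be row-finite directed graphs with no sources, let $R$ be an integral domain with identity, and let $S$ be a commutative ring with identity. Suppose that there is a ring $*$-isomorphism $\pi: L_R(E)\to L_R(F)$ such that $\pi(D(E))=D(F)$. Then there exists an $S$-algebra $*$-isomorphism of $L_S(E)$ onto $L_S(F)$. Further, there is a $C^*$-algebra isomorphism of $C^*(E)$ onto $C^*(F)$.
   Context: A directed graph $E=(E^0,E^1,r,s)$ consists of countable sets $E^0$ (vertices), $E^1$ (edges) and maps $r,s:E^1\to E^0$. It is row-finite if $r^{-1}(v)$ is finite for every $v\in E^0$, and has no sources if $r^{-1}(v)\neq\emptyset$ for every $v$. Paths are sequences of edges $\mu=\mu_1\mu_2\cdots$ with $s(\mu_i)=r(\mu_{i+1})$; $P(E)$ is the set of finite paths (vertices are paths of length $0$). Each coefficient ring $R$, $S$ is commutative and carries an involution $r\mapsto\overline r$ (a ring automorphism with $\overline{\overline r}=r$; complex conjugation for subrings of $\mathbb{C}$), the same one being used for $E$ and $F$. Leavitt path algebra: for a commutative ring $R$ with identity, $L_R(E)$ is the universal $R$-algebra generated by $\{p_v,s_e,s_{e^*}: v\in E^0,e\in E^1\}$ where the $p_v$ are mutually orthogonal idempotents, $p_{r(e)}s_e=s_e=s_ep_{s(e)}$, $p_{s(e)}s_{e^*}=s_{e^*}=s_{e^*}p_{r(e)}$, $s_{e^*}s_f=\delta_{e,f}p_{s(e)}$, and $p_v=\sum_{r(e)=v}s_es_{e^*}$. With $s_\mu=s_{\mu_1}\cdots s_{\mu_{|\mu|}}$ and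 $s_{\mu^*}=s_{\mu_{|\mu|}^*}\cdots s_{\mu_1^*}$ (and $s_v=s_{v^*}=p_v$), it is spanned over $R$ by the $s_\mu s_{\nu^*}$; its involution is $\sum r_{\mu,\nu}s_\mu s_{\nu^*}\mapsto\sum\overline{r_{\mu,\nu}}s_\nu s_{\mu^*}$, and its diagonal is $D(E)=\operatorname{span}_R\{s_\mu s_{\mu^*}:\mu\in P(E)\}$. A ring $*$-isomorphism is a ring isomorphism preserving the involutions (not assumed $R$-linear). Graph $C^*$-algebra: $C^*(E)$ is the universal $C^*$-algebra generated by mutually orthogonal projections $\{P_v:v\in E^0\}$ and partial isometries $\{S_e:e\in E^1\}$ with $S_e^*S_e=P_{s(e)}$ and $P_v=\sum_{r(e)=v}S_eS_e^*$. *)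

(* Defs.v *)
From HB Require Import structures.
From mathcomp Require Import all_boot all_order all_algebra.
From mathcomp Require Import all_classical all_reals all_analysis.
From mathcomp.real_closed Require Import complex.

Set Implicit Arguments.
Unset Strict Implicit.
Unset Printing Implicit Defensive.

Import Order.TTheory GRing.Theory Num.Theory.
Import numFieldNormedType.Exports.

Local Open Scope classical_set_scope.
Local Open Scope ring_scope.

(* L_R(E) and C^*(E) have no unit when E has infinitely many vertices, so both
   live in categories of possibly non-unital algebras, and both are specified,
   up to unique isomorphism, by their universal properties. *)

Record digraph := Digraph {
  vert : countType;
  edge : countType;
  rng : edge -> vert;
  src : edge -> vert }.

Arguments rng {_} _.
Arguments src {_} _.

Definition edges_into (E : digraph) (v : vert E) : set (edge E) :=
  [set e | rng e = v].

Definition row_finite (E : digraph) : Prop :=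
  forall v : vert E, finite_set (edges_into v).

Definition no_sources (E : digraph) : Prop :=
  forall v : vert E, edges_into v !=set0.

(* The sequence e :: l stands for the path e l_1 l_2 ...; consecutive edges
   satisfy s(mu_i) = r(mu_(i+1)). *)
Inductive gpath (E : digraph) : Type :=
| VertexPath of vert E
| EdgePath (e : edge E) (l : seq (edge E)) of
    path (fun f g => src f == rng g) e l.

(* s_mu and s_(mu^* ), from families of elements of a set with a product. *)
Definition gpath_elt (E : digraph) (A : Type) (mul : A -> A -> A)
    (p : vert E -> A) (s : edge E -> A) (mu : gpath E) : A :=
  match mu with
  | VertexPath v => p v
  | EdgePath e l _ => foldl (fun x f => mul x (s f)) (s e) l
  end.

Definition gpath_ghost (E : digraph) (A : Type) (mul : A -> A -> A)
    (p : vert E -> A) (t : edge E -> A) (mu : gpath E) : A :=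
  match mu with
  | VertexPath v => p v
  | EdgePath e l _ => foldl (fun x f => mul (t f) x) (t e) l
  end.

Record algebra_mul (R : comPzRingType) (A : lmodType R) (mul : A -> A -> A) :
    Prop := AlgebraMul {
  amulA : associative mul;
  amulDl : left_distributive mul +%R;
  amulDr : right_distributive mul +%R;
  amulZl : forall (a : R) (x y : A), mul (a *: x) y = a *: mul x y;
  amulZr : forall (a : R) (x y : A), mul x (a *: y) = a *: mul x y }.

Record algebra (R : comPzRingType) := Algebra {
  alg_sort :> lmodType R;
  amul : alg_sort -> alg_sort -> alg_sort;
  amulP : algebra_mul amul }.

Arguments amul {R _} _ _.

Definition algebra_hom (R : comPzRingType) (A B : algebra R) (f : A -> B) :
    Prop :=
  linear f /\ {morph f : x y / amul x y >-> amul x y}.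

(* The sum in the last relation is the library's finitely supported sum; it is
   the intended one because edges_into v is finite when E is row-finite. *)
Record leavitt_family (R : comPzRingType) (E : digraph) (A : algebra R)
    (p : vert E -> A) (s t : edge E -> A) : Prop := LeavittFamily {
  lf_idem : forall v, amul (p v) (p v) = p v;
  lf_orth : forall v w, v != w -> amul (p v) (p w) = 0;
  lf_rs : forall e, amul (p (rng e)) (s e) = s e;
  lf_ss : forall e, amul (s e) (p (src e)) = s e;
  lf_st : forall e, amul (p (src e)) (t e) = t e;
  lf_rt : forall e, amul (t e) (p (rng e)) = t e;
  lf_ck1 : forall e f, amul (t e) (s f) = if e == f then p (src e) else 0;
  lf_ck2 : forall v,
    p v = \sum_(e \in edges_into v) amul (s e) (t e) }.

(* L_R(E) with its generators and, for an involution conjR of R, its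
   involution. *)
Record leavitt_algebra (R : comPzRingType) (conjR : R -> R) (E : digraph) :=
    LeavittAlgebra {
  la_alg :> algebra R;
  la_p : vert E -> la_alg;
  la_s : edge E -> la_alg;
  la_t : edge E -> la_alg;
  la_family : leavitt_family la_p la_s la_t;
  la_universal : forall (B : algebra R) (q : vert E -> B) (u w : edge E -> B),
    leavitt_family q u w ->
    exists! f : la_alg -> B, algebra_hom f /\
      [/\ forall v, f (la_p v) = q v,
          forall e, f (la_s e) = u e &
          forall e, f (la_t e) = w e];
  la_star : la_alg -> la_alg;
  la_starD : {morph la_star : x y / x + y};
  la_starZ : forall (a : R) (mu nu : gpath E),
    la_star (a *: amul (gpath_elt amul la_p la_s mu)
                       (gpath_ghost amul la_p la_t nu)) =
    conjR a *: amul (gpath_elt amul la_p la_s nu)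
                    (gpath_ghost amul la_p la_t mu) }.

Section LeavittNotions.
Variables (R : comPzRingType) (conjR : R -> R) (E : digraph).

Definition la_diag_elt (L : leavitt_algebra conjR E) (mu : gpath E) : L :=
  amul (gpath_elt amul (@la_p _ _ _ L) (@la_s _ _ _ L) mu)
       (gpath_ghost amul (@la_p _ _ _ L) (@la_t _ _ _ L) mu).

Definition la_diag (L : leavitt_algebra conjR E) : set L :=
  [set x | exists (n : nat) (a : 'I_n -> R) (mu : 'I_n -> gpath E),
    x = \sum_(i < n) a i *: la_diag_elt L (mu i)].

End LeavittNotions.

Arguments la_diag {R conjR E} L _.
Arguments la_diag_elt {R conjR E} L mu.

Definition leavitt_ring_star_iso (R R' : comPzRingType) (conjR : R -> R)
    (conjR' : R' -> R') (E F : digraph) (L : leavitt_algebra conjR E)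
    (M : leavitt_algebra conjR' F) (f : L -> M) : Prop :=
  [/\ bijective f,
      {morph f : x y / x + y},
      {morph f : x y / amul x y >-> amul x y} &
      {morph f : x / la_star x >-> la_star x}].

Definition leavitt_algebra_star_iso (R : comPzRingType) (conjR : R -> R)
    (E F : digraph) (L : leavitt_algebra conjR E) (M : leavitt_algebra conjR F)
    (f : L -> M) : Prop :=
  [/\ bijective f, algebra_hom f & {morph f : x / la_star x >-> la_star x}].

Record cstar_algebra (K : realType) := CStarAlgebra {
  cs_sort :> completeNormedModType K[i];
  cmul : cs_sort -> cs_sort -> cs_sort;
  cmulP : algebra_mul cmul;
  cstar : cs_sort -> cs_sort;
  cstarD : {morph cstar : x y / x + y};
  cstarZ : forall (a : K[i]) (x : cs_sort), cstar (a *: x) = a^* *: cstar x;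
  cstarM : forall x y, cstar (cmul x y) = cmul (cstar y) (cstar x);
  cstarK : involutive cstar;
  cnormM : forall x y, `|cmul x y| <= `|x| * `|y|;
  cnorm_star : forall x, `|cmul (cstar x) x| = `|x| ^+ 2 }.

Arguments cmul {K _} _ _.
Arguments cstar {K _} _.

(* No continuity clause: a *-homomorphism of C^*-algebras is automatically
   contractive, and an injective one isometric. *)
Definition cstar_hom (K : realType) (A B : cstar_algebra K) (f : A -> B) :
    Prop :=
  [/\ linear f,
      {morph f : x y / cmul x y >-> cmul x y} &
      {morph f : x / cstar x >-> cstar x}].

Definition cstar_iso (K : realType) (A B : cstar_algebra K) (f : A -> B) :
    Prop :=
  bijective f /\ cstar_hom f.

Definition projection (K : realType) (A : cstar_algebra K) (x : A) : Prop :=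
  cmul x x = x /\ cstar x = x.

Definition partial_isometry (K : realType) (A : cstar_algebra K) (x : A) :
    Prop :=
  cmul (cmul x (cstar x)) x = x.

Record ck_family (K : realType) (E : digraph) (A : cstar_algebra K)
    (P : vert E -> A) (S : edge E -> A) : Prop := CKFamily {
  ck_proj : forall v, projection (P v);
  ck_orth : forall v w, v != w -> cmul (P v) (P w) = 0;
  ck_piso : forall e, partial_isometry (S e);
  ck_src : forall e, cmul (cstar (S e)) (S e) = P (src e);
  ck_rng : forall v,
    P v = \sum_(e \in edges_into v) cmul (S e) (cstar (S e)) }.

Record graph_cstar_algebra (K : realType) (E : digraph) :=
    GraphCStarAlgebra {
  gc_alg :> cstar_algebra K;
  gc_P : vert E -> gc_alg;
  gc_S : edge E -> gc_alg;
  gc_family : ck_family gc_P gc_S;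
  gc_universal : forall (B : cstar_algebra K) (Q : vert E -> B)
      (T : edge E -> B),
    ck_family Q T ->
    exists! f : gc_alg -> B, cstar_hom f /\
      (forall v, f (gc_P v) = Q v) /\ (forall e, f (gc_S e) = T e) }.

(* Main.v *)
Require Import Defs.
From HB Require Import structures.
From mathcomp Require Import all_boot all_order all_algebra.
From mathcomp Require Import all_classical all_reals all_analysis.
From mathcomp.real_closed Require Import complex.
From mathcomp Require Import zify ring lra.

Set Implicit Arguments.
Unset Strict Implicit.
Unset Printing Implicit Defensive.

Import Order.TTheory GRing.Theory Num.Theory.
Import numFieldNormedType.Exports.

Local Open Scope classical_set_scope.
Local Open Scope ring_scope.

(** The idea is to extract from the isomorphism pi a combinatorial object that
    does not involve R and that can be used over any coefficients. It lives on
    the path groupoid of a graph, which consists of the triples (x, k, y) such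
    that the infinite paths x and y agree after deleting m and n initial edges,
    for some m and n with k = m - n. A monomial s_mu s_nu^* is the indicator
    function of the set Z(mu, nu) of the triples (mu z, |mu| - |nu|, nu z).

    Groupoid coefficients. For each commutative ring S the span of these
    indicator functions is an algebra under convolution. Its elements act
    faithfully on functions of a path and an integer, and this makes the
    convolution product associative without any computation. Refining all the
    s_mu s_nu^* to a common length of nu makes their supports disjoint, so a
    formal sum whose function vanishes has value zero in every algebra with a
    Leavitt family ([eq_gcoef_eval]). Together with the universal property this
    identifies L_R(E) with an algebra of functions ([coef_inj], [coef_row],
    [coef_star]), in which D(E) consists of functions supported on the triples
    (x, 0, x).

    Normalizers. Each n = pi(s_e) satisfies n D n^* in D and n^* D n in D. If R
    is a domain, the support of such an n is a bisection: it has at most one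
    element with a given source, and at most one with a given range. Over a
    path y take the germ of largest degree and the germ of smallest degree; the
    coefficient of n d n^* at their quotient, with d the indicator of a small
    cylinder around y, reduces to a single non-zero product, so the quotient is
    a unit ([extremal_germs], [normalizer_src_unique]). Supports of bisections
    multiply as sets, since R has no zero divisors.

    Transport. For any algebra A with a Leavitt family of F, the support of an
    element a of L_R(F) is a disjoint union of sets Z(mu, nu), and the sum of
    the corresponding s_mu s_nu^* in A is an element [transport a] that does not
    depend on the decomposition. It is multiplicative on bisections, additive
    on disjoint supports and compatible with involutions. Hence the elements
    transport (pi(p_v)), transport (pi(s_e)), transport (pi(s_e^* )) form a
    Leavitt family of E in A ([new_family]), which defines a homomorphism out
    of the universal algebra of E. The inverse of pi gives a homomorphism in
    the other direction. The two are mutually inverse ([inverse_generators]):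
    the coefficients c of n = pi(s_e) satisfy (conj c) c = 1, and multiplying a
    monomial by such a scalar does not change the support of its image under
    the inverse of pi.

    For A = L_S(F) this is the first claim. For A = C^*(F) one also has to know
    that a Cuntz-Krieger family is a Leavitt family, which amounts to the
    orthogonality of projections that sum to a projection
    ([sum_proj_orth]). It follows from the fact that the unit of a Banach
    algebra is an extreme point of its unit ball ([unit_extreme]), which has an
    elementary proof. *)

(** * Infinite paths and monomials *)

Lemma sum_fibers (V : nmodType) (I T : eqType) (s : seq I) (h : I -> T)
    (F : I -> V) :
  \sum_(i <- s) F i =
  \sum_(t <- undup (map h s)) \sum_(i <- s | h i == t) F i.
Proof.
under [RHS]eq_bigr do rewrite big_mkcond.
rewrite exchange_big /= big_seq [RHS]big_seq; apply: eq_bigr => i si.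
rewrite (bigD1_seq (h i)) ?undup_uniq ?mem_undup ?map_f //=.
by rewrite eqxx big1 ?addr0 // => t; rewrite eq_sym => /negbTE ->.
Qed.

Lemma uniq_map_inj (T U : eqType) (h : T -> U) (s : seq T) a b :
  uniq (map h s) -> a \in s -> b \in s -> h a = h b -> a = b.
Proof.
elim: s => //= c s IH /andP[nc us]; rewrite !inE.
move=> /predU1P[->|sa] /predU1P[->|sb] // hab; last exact: IH.
  by case/negP: nc; rewrite hab map_f.
by case/negP: nc; rewrite -hab map_f.
Qed.

Section Streams.
Variable E : digraph.
Local Notation X := (nat -> edge E).
Implicit Types (x y z : X) (e f : edge E) (l : seq (edge E)) (v w : vert E).

(** Infinite paths are the sequences of edges that satisfy this test; other
    sequences belong to no set Z(mu, nu). *)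
Definition is_path x : bool := `[< forall n, src (x n) = rng (x n.+1) >].

Definition scons e x : X := fun n => if n is m.+1 then x m else e.
Definition shift x : X := fun n => x n.+1.
Definition scat l x : X := foldr scons x l.
Definition sdrop k x : X := iter k shift x.

Lemma sdropS k x : sdrop k.+1 x = sdrop k (shift x).
Proof. exact: iterSr. Qed.

Lemma shift_scons e x : shift (scons e x) = x.
Proof. by []. Qed.

Lemma scons_eta x : scons (x 0%N) (shift x) = x.
Proof. by apply/funext => -[]. Qed.

Lemma scons_inj e f x y : scons e x = scons f y -> e = f /\ x = y.
Proof.
move=> h; split; first exact: (congr1 (fun g : X => g 0%N) h).
exact: (congr1 shift h).
Qed.

Lemma eq_scons e x y : (x == scons e y) = (x 0%N == e) && (shift x == y).
Proof.
apply/eqP/andP => [->|[/eqP <- /eqP <-]]; first by rewrite /= !eqxx.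
by rewrite scons_eta.
Qed.

Lemma is_path_scons e x :
  is_path (scons e x) = (src e == rng (x 0%N)) && is_path x.
Proof.
apply/asboolP/andP => [h|[/eqP h /asboolP h']].
  split; first by apply/eqP; exact: (h 0%N).
  by apply/asboolP => n; exact: (h n.+1).
by case=> [|n] //; exact: h'.
Qed.

Lemma is_path_shift x : is_path x -> is_path (shift x).
Proof. by rewrite -{1}(scons_eta x) is_path_scons => /andP[]. Qed.

Lemma is_path_src x : is_path x -> src (x 0%N) = rng (shift x 0%N).
Proof. by move=> /asboolP h; exact: h. Qed.

Lemma scat_cat l l' x : scat (l ++ l') x = scat l (scat l' x).
Proof. by rewrite /scat foldr_cat. Qed.

Lemma scat_rcons l e x : scat (rcons l e) x = scat l (scons e x).
Proof. by rewrite -cats1 scat_cat. Qed.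

Lemma sdrop_scat l x : sdrop (size l) (scat l x) = x.
Proof. by elim: l => // e l IH; rewrite [size _]/= sdropS. Qed.

Lemma is_path_scat l x : is_path (scat l x) -> is_path x.
Proof. by elim: l => //= e l IH; rewrite is_path_scons => /andP[_ /IH]. Qed.

Lemma scat_inj l l' x y : size l = size l' -> scat l x = scat l' y ->
  l = l' /\ x = y.
Proof.
elim: l l' => [|e l IH] [|f l'] //= [] /IH {}IH.
by move=> /scons_inj[-> /IH[-> ->]].
Qed.

(** The triple (l, v, l') stands for the product s_l p_v t_l', that is for
    s_mu s_nu^* where mu and nu are the paths with edges l and l' and common
    source v. With the vertex in the middle, paths of length zero are not a
    special case. *)
Definition monomial : choiceType := (seq (edge E) * vert E * seq (edge E))%type.
Implicit Type m : monomial.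

(** The set Z(l, v, l') is the graph of a partial map on infinite paths, which
   replaces the initial segment l by l'. *)
Definition mtarget m x : X := scat m.2 (sdrop (size m.1.1) x).
Definition mdegree m : int := (size m.1.1)%:Z - (size m.2)%:Z.

Definition mdomain m x : bool :=
  [&& is_path x, x == scat m.1.1 (sdrop (size m.1.1) x),
      rng (sdrop (size m.1.1) x 0%N) == m.1.2 & is_path (mtarget m x)].

Definition msupp m x (k : int) y : bool :=
  [&& mdomain m x, mtarget m x == y & k == mdegree m].

Lemma mdomain_consl e l v l' x :
  mdomain (e :: l, v, l') x = [&& is_path x, x 0%N == e & mdomain (l, v, l')
    (shift x)].
Proof.
rewrite /mdomain /mtarget [size _]/= sdropS /= eq_scons.
case px: (is_path x) => //=; rewrite (is_path_shift px) /=.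
by case: (x 0%N == e).
Qed.

Lemma mtarget_consl e l v l' x : mtarget (e :: l, v, l') x =
  mtarget (l, v, l') (shift x).
Proof. by rewrite /mtarget [size _]/= sdropS. Qed.

Lemma mdomain_consr v e l' x : mdomain ([::], v, e :: l') x =
  mdomain ([::], v, l') x && (src e == rng (mtarget ([::], v, l') x 0%N)).
Proof.
rewrite /mdomain /mtarget /= is_path_scons.
by case: (is_path x); case: (rng (x 0%N) == v); case: (src e == _);
  rewrite ?andbT ?andbF.
Qed.

Lemma msuppP m x k y : reflect
  (exists z, [/\ x = scat m.1.1 z, y = scat m.2 z & rng (z 0%N) = m.1.2] /\
             [/\ is_path x, is_path y & k = mdegree m])
  (msupp m x k y).
Proof.
apply: (iffP and3P) => [[/and4P[px /eqP ex /eqP rv py] /eqP ey /eqP ek]|].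
  exists (sdrop (size m.1.1) x); split => //; by rewrite -ey.
move=> [z [[-> -> rv] [px py ->]]]; rewrite /mdomain /mtarget !sdrop_scat.
by rewrite px py rv !eqxx.
Qed.

(** The inverse of Z(mu, nu) in the groupoid is Z(nu, mu). *)
Definition mflip m : monomial := (m.2, m.1.2, m.1.1).

Lemma msupp_flip m x k y : msupp (mflip m) x k y = msupp m y (- k) x.
Proof.
apply/msuppP/msuppP => -[z [[-> -> rv] [px py ek]]]; exists z; do !split => //=.
- by rewrite ek /mdegree /= opprB.
- by rewrite -(opprK k) ek /mdegree /= opprB.
Qed.

(** The degree and the length of the second path determine the length of the
    first; the point (x, k, y) then determines both paths. *)
Lemma msupp_inj m m' x k y : size m.2 = size m'.2 ->
  msupp m x k y -> msupp m' x k y -> m = m'.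
Proof.
case: m m' => [[l v] l1] [[l' v'] l1'] /= s2.
move=> /msuppP /= [z [[ex ey rz] [px py ek]]] /msuppP /=
  [z' [[ex' ey' rz'] [_ _ ek']]].
have s1 : size l = size l'.
  by move: ek; rewrite ek' /mdegree /= s2 => /addIr [].
have [<- zz] : l = l' /\ z = z' by apply: scat_inj => //; rewrite -ex.
have [<- _] : l1 = l1' /\ z = z' by apply: scat_inj => //; rewrite -ey.
by rewrite -rz -rz' zz.
Qed.

End Streams.

(** * The regular action of formal sums *)

Section Action.
Variables (E : digraph) (S : comPzRingType).
Local Notation X := (nat -> edge E).
Local Notation monomial := (monomial E).
Implicit Types (x y z : X) (e f : edge E) (l : seq (edge E)) (v w : vert E).
Implicit Types (m : monomial) (xi : X -> int -> S) (la lb : seq (S * monomial)).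

(** The generators act on functions of an infinite path and an integer as
    partial changes of variable that lengthen or shorten the path. The integer
    records the change of length: without it a cycle without exit would act like
    its vertex, and the action would not be faithful. *)
Definition pull (b : X -> bool) (phi : X -> X) (c : int)
    (xi : X -> int -> S) x (k : int) : S :=
  if b x then xi (phi x) (k + c) else 0.

Definition mact m := pull (mdomain m) (mtarget m) (- mdegree m).

Definition act la xi x k : S := \sum_(p <- la) p.1 * mact p.2 xi x k.

Definition delta y : X -> int -> S := fun x k => ((x == y) && (k == 0))%:R.

Definition gcoef la x k y : S := \sum_(p <- la) p.1 * (msupp p.2 x k y)%:R.

Lemma mact_delta m x k y : mact m (delta y) x k = (msupp m x k y)%:R.
Proof.
by rewrite /mact /pull /delta /msupp subr_eq0; case: ifP.
Qed.

Lemma act_delta la x k y : act la (delta y) x k = gcoef la x k y.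
Proof. by apply: eq_bigr => p _; rewrite mact_delta. Qed.

Definition actS e := pull (fun x => is_path x && (x 0%N == e)) (@shift E) (- 1).
Definition actT e :=
  pull (fun x => is_path x && (src e == rng (x 0%N))) (scons e) 1.
Definition actP v :=
  pull (fun x => is_path x && (rng (x 0%N) == v)) id 0.

Lemma mact_consl e l v l' xi :
  mact (e :: l, v, l') xi = actS e (mact (l, v, l') xi).
Proof.
apply/funext => x; apply/funext => k.
rewrite /mact /actS /pull mdomain_consl mtarget_consl.
case: (is_path x) => //=; case: (_ == e) => //=.
case: (mdomain (l, v, l') _) => //.
by congr (xi _ _); rewrite /mdegree /=; lia.
Qed.

Lemma mact_consr v e l' xi :
  mact ([::], v, e :: l') xi = mact ([::], v, l') (actT e xi).
Proof.
apply/funext => x; apply/funext => k.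
rewrite /mact /actT /pull mdomain_consr.
case: ifP => [/andP[d ->]|].
  rewrite d; case/and4P: d => _ _ _ -> /=.
  by congr (xi _ _); rewrite /mdegree /=; lia.
case d : (mdomain _ x) => //= ->; by rewrite andbF.
Qed.

Lemma mact_vert v xi : mact ([::], v, [::]) xi = actP v xi.
Proof.
apply/funext => x; apply/funext => k.
rewrite /mact /actP /pull /mdomain /mtarget /= eqxx /= /mdegree /=
  subrr oppr0 addr0.
by case: (is_path x) => //=; rewrite andbT.
Qed.

Definition path_range l v : vert E := if l is e :: _ then rng e else v.

(** The product of a generator and a monomial is a monomial or zero, hence a
    list of at most one monomial. *)
Definition mmulP w m : seq monomial :=
  if path_range m.1.1 m.1.2 == w then [:: m] else [::].
Definition mmulS e m : seq monomial := [:: (e :: m.1.1, m.1.2, m.2)].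
Definition mmulT e m : seq monomial :=
  if m.1.1 is f :: l then
    if (e == f) && (path_range l m.1.2 == src e) then [:: (l, m.1.2, m.2)] else
      [::]
  else if rng e == m.1.2 then [:: ([::], src e, rcons m.2 e)] else [::].

Lemma mmulS_act e m xi x k :
  actS e (mact m xi) x k = \sum_(m' <- mmulS e m) mact m' xi x k.
Proof. by case: m => [[l v] l']; rewrite big_seq1 -mact_consl. Qed.

Lemma mact_supp l v l' xi x k :
  mact (l, v, l') xi x k = if is_path x && (rng (x 0%N) == path_range l v)
    then mact (l, v, l') xi x k else 0.
Proof.
case: ifPn => //; rewrite /mact /pull; case:
  ifP => // /and4P[-> /eqP xe /eqP rv _].
rewrite negb_and /=.
by case: l xe rv => [|e l] /= xe rv; rewrite ?rv ?eqxx // xe /= eqxx.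
Qed.

Lemma mmulP_act w m xi x k :
  actP w (mact m xi) x k = \sum_(m' <- mmulP w m) mact m' xi x k.
Proof.
case: m => [[l v] l']; rewrite /mmulP /= /actP /pull addr0.
rewrite mact_supp; case: (eqVneq (path_range l v) w) => [<-|nw].
  by rewrite big_seq1 [in RHS]mact_supp; case: (is_path x && _).
rewrite big_nil; case: ifP => // /andP[-> /eqP ->] /=.
by rewrite eq_sym (negbTE nw).
Qed.

Lemma mmulT_act e m xi x k :
  actT e (mact m xi) x k = \sum_(m' <- mmulT e m) mact m' xi x k.
Proof.
case: m => [[[|f l] v] l']; rewrite /mmulT /= /actT /pull.
  case: (eqVneq (rng e) v) => [rev|nv]; last first.
    rewrite big_nil; case: ifP => // _; rewrite /mact /pull /mdomain /=.
    by rewrite (negbTE nv) /= !andbF.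
  rewrite big_seq1 /mact /pull /mdomain /mtarget /= !eqxx rev eqxx /=.
  rewrite is_path_scons scat_rcons [in X in X && (_ == _)]/=.
  case: (is_path x) => //=; rewrite andbT eq_sym; case: eqP => //= _.
  by case: ifP => // _; congr (xi _ _); rewrite /mdegree /= size_rcons; lia.
rewrite mact_consl /actS /pull is_path_scons shift_scons /=.
rewrite [mact _ _ x _]mact_supp addrK.
case: (e == f) => /=; last by rewrite big_nil andbF; case: ifP.
rewrite andbT; case rm: (path_range l v == src e).
  rewrite big_seq1 [RHS]mact_supp (eqP rm) [rng _ == _]eq_sym.
  by case: (is_path x); case: (src e == rng (x 0%N)).
rewrite big_nil; case sx: (src e == rng (x 0%N)); last by rewrite andbF.
by rewrite -(eqP sx) eq_sym rm andbF !if_same.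
Qed.

Definition flift (g : monomial -> seq monomial) la : seq (S * monomial) :=
  flatten [seq [seq (p.1, m) | m <- g p.2] | p <- la].

Lemma sum_flift (V : lmodType S) (F : monomial -> V) g la :
  \sum_(p <- flift g la) p.1 *: F p.2 =
  \sum_(p <- la) p.1 *: \sum_(m <- g p.2) F m.
Proof.
rewrite /flift big_flatten big_map; apply: eq_bigr => p _.
by rewrite big_map /= scaler_sumr.
Qed.

Lemma act_flift b phi c g la xi x k :
  (forall m x k, pull b phi c (mact m xi) x k =
     \sum_(m' <- g m) mact m' xi x k) ->
  act (flift g la) xi x k = pull b phi c (act la xi) x k.
Proof.
move=> h; rewrite /act.
rewrite (sum_flift (V := S^o) (fun m => mact m xi x k)).
rewrite /pull; case: ifPn => bx.
  by apply: eq_bigr => p _; rewrite -h /pull bx.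
by rewrite big1 // => p _; rewrite -h /pull (negbTE bx) scaler0.
Qed.

(** The product of formal sums reduces to left multiplication by generators:
    the monomial s_l p_v t_l' is applied one letter at a time. *)
Definition fmulm m la : seq (S * monomial) :=
  foldr (fun e => flift (mmulS e))
    (flift (mmulP m.1.2) (foldl (fun b e => flift (mmulT e) b) la m.2)) m.1.1.

Definition fmul la lb : seq (S * monomial) :=
  flatten [seq [seq (p.1 * q.1, q.2) | q <- fmulm p.2 lb] | p <- la].

Lemma act_fmulm m la xi : act (fmulm m la) xi = mact m (act la xi).
Proof.
have actS_flift e lb : act (flift (mmulS e) lb) xi = actS e (act lb xi).
  apply/funext => x; apply/funext => k.
  by apply: act_flift => *; exact: mmulS_act.
have actT_flift e lb : act (flift (mmulT e) lb) xi = actT e (act lb xi).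
  apply/funext => x; apply/funext => k.
  by apply: act_flift => *; exact: mmulT_act.
have actP_flift v lb : act (flift (mmulP v) lb) xi = actP v (act lb xi).
  apply/funext => x; apply/funext => k.
  by apply: act_flift => *; exact: mmulP_act.
case: m => [[l v] l']; rewrite /fmulm /=; elim: l => [|e l IH] /=; last first.
  by rewrite actS_flift mact_consl IH.
elim: l' la => [|e l' IH] la /=; first by rewrite mact_vert actP_flift.
by rewrite IH mact_consr actT_flift.
Qed.

Lemma act_fmul la lb xi : act (fmul la lb) xi = act la (act lb xi).
Proof.
apply/funext => x; apply/funext => k.
rewrite /fmul [LHS]/act big_flatten big_map; apply: eq_bigr => p _.
rewrite big_map -act_fmulm /act mulr_sumr.
by apply: eq_bigr => q _ /=; rewrite mulrA.
Qed.

(** The matrix of a formal sum has finitely many non-zero entries in each row,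
    and they are its groupoid coefficients; this is the convolution formula. *)
Lemma act_row la x : exists s : seq (int * X)%type, uniq s /\
  (forall k y, (k, y) \notin s -> gcoef la x k y = 0) /\
  forall xi k, act la xi x k = \sum_(q <- s) gcoef la x q.1 q.2 * xi q.2
    (k - q.1).
Proof.
pose dm := [seq p <- la | mdomain p.2 x].
pose pt (p : S * monomial) := (mdegree p.2, mtarget p.2 x).
exists (undup (map pt dm)); split; first exact: undup_uniq.
have coE k y : gcoef la x k y = \sum_(p <- dm | pt p == (k, y)) p.1.
  rewrite big_filter_cond big_mkcond; apply: eq_bigr => p _.
  rewrite /msupp /pt xpair_eqE [k == _]eq_sym; case: mdomain => /=;
    last exact: mulr0.
  by rewrite andbC; case: (_ && _); rewrite ?mulr1 ?mulr0.
split=> [k y|xi k].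
  rewrite mem_undup coE => h; rewrite big_seq_cond big1 // =>
    p /andP[pd /eqP pe].
  by move: h; rewrite -pe map_f.
have -> : act la xi x k = \sum_(p <- dm) p.1 * xi (pt p).2 (k - (pt p).1).
  rewrite big_filter [RHS]big_mkcond; apply: eq_bigr => p _.
  by rewrite /mact /pull; case: ifP => // _; rewrite mulr0.
transitivity (\sum_(q <- undup (map pt dm)) \sum_(p <- dm | pt p == q)
    p.1 * xi (pt p).2 (k - (pt p).1)).
  exact: sum_fibers.
apply: eq_bigr => q _; rewrite coE mulr_suml; apply: eq_bigr => p.
by move=> /eqP ->.
Qed.

Definition fscale (c : S) la : seq (S * monomial) :=
  [seq (c * p.1, p.2) | p <- la].

Lemma act_cat la lb xi x k : act (la ++ lb) xi x k =
  act la xi x k + act lb xi x k.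
Proof. by rewrite /act big_cat. Qed.

Lemma act_fscale c la xi x k : act (fscale c la) xi x k = c * act la xi x k.
Proof.
by rewrite /act big_map mulr_sumr; apply: eq_bigr => p _; rewrite mulrA.
Qed.

Lemma gcoef_cat la lb x k y : gcoef (la ++ lb) x k y =
  gcoef la x k y + gcoef lb x k y.
Proof. by rewrite -!act_delta act_cat. Qed.

Lemma gcoef_fscale c la x k y : gcoef (fscale c la) x k y = c * gcoef la x k y.
Proof. by rewrite -!act_delta act_fscale. Qed.

Lemma gcoef_fmul la lb x k z : gcoef (fmul la lb) x k z =
  act la (fun y j => gcoef lb y j z) x k.
Proof.
rewrite -act_delta act_fmul; congr (act la _ x k).
by apply/funext => y; apply/funext => j; rewrite act_delta.
Qed.

(** In particular the action depends only on the function on the groupoid. *)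
Lemma eq_gcoef_act la lb : gcoef la = gcoef lb -> act la = act lb.
Proof.
move=> h; apply/funext => xi; apply/funext => x; apply/funext => k.
have [s [_ [_ e]]] := act_row (la ++ fscale (- 1) lb) x.
apply/eqP; rewrite -subr_eq0 -mulN1r -act_fscale -act_cat e big1 // => q _.
by rewrite gcoef_cat gcoef_fscale h mulN1r subrr mul0r.
Qed.

End Action.

(** * Evaluation of formal sums in an algebra *)

Section AlgebraMul.
Variables (S : comPzRingType) (A : algebra S).
Implicit Types a b : A.

Lemma amul0 a : amul a 0 = 0.
Proof. by rewrite -(scale0r (0 : A)) (amulZr (amulP A)) !scale0r. Qed.

Lemma amul0r a : amul 0 a = 0.
Proof. by rewrite -(scale0r (0 : A)) (amulZl (amulP A)) !scale0r. Qed.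

Lemma amul_suml I (r : seq I) (P : pred I) (F : I -> A) b :
  amul (\sum_(i <- r | P i) F i) b = \sum_(i <- r | P i) amul (F i) b.
Proof.
apply: (big_morph (fun a => amul a b)); last exact: amul0r.
by move=> x y; rewrite (amulDl (amulP A)).
Qed.

Lemma amul_sumr I (r : seq I) (P : pred I) (F : I -> A) b :
  amul b (\sum_(i <- r | P i) F i) = \sum_(i <- r | P i) amul b (F i).
Proof.
apply: (big_morph (fun a => amul b a)); last exact: amul0.
by move=> x y; rewrite (amulDr (amulP A)).
Qed.

End AlgebraMul.

Section Evaluation.
Variables (E : digraph) (S : comPzRingType) (A : algebra S).
Variables (p : vert E -> A) (s t : edge E -> A).
Local Notation monomial := (monomial E).
Implicit Types (e f : edge E) (l : seq (edge E)) (v w : vert E).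
Implicit Types (m : monomial) (la lb : seq (S * monomial)).

Definition meval m : A :=
  foldr (fun e a => amul (s e) a)
    (foldr (fun e a => amul a (t e)) (p m.1.2) m.2) m.1.1.

Definition eval la : A := \sum_(q <- la) q.1 *: meval q.2.

Hypothesis fam : leavitt_family p s t.
Local Notation mulA := (amulA (amulP A)).

Lemma meval_amul l v l' : meval (l, v, l') =
  foldr (fun e a => amul (s e) a) (meval ([::], v, l')) l.
Proof. by []. Qed.

Lemma meval_pl v l' : amul (p v) (meval ([::], v, l')) = meval ([::], v, l').
Proof.
rewrite /meval /=; elim: l' => [|e l' IH] /=; first exact: (lf_idem fam).
by rewrite mulA IH.
Qed.

Lemma mmulS_meval e m : amul (s e) (meval m) = \sum_(m' <- mmulS e m) meval m'.
Proof. by rewrite big_seq1. Qed.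

Lemma mmulP_meval w m : amul (p w) (meval m) = \sum_(m' <- mmulP w m) meval m'.
Proof.
case: m => [[l v] l']; rewrite /mmulP /= eq_sym.
have [->|nw] := eqVneq w.
  rewrite big_seq1; case: l => [|e l] /=; first exact: meval_pl.
  by rewrite /meval /= mulA (lf_rs fam).
rewrite big_nil; case: l nw => [|e l] /= nw.
  by rewrite -meval_pl mulA (lf_orth fam) // amul0r.
by rewrite /meval /= mulA -(lf_rs fam) mulA (lf_orth fam) // !amul0r.
Qed.

Lemma mmulT_meval e m : amul (t e) (meval m) = \sum_(m' <- mmulT e m) meval m'.
Proof.
case: m => [[[|f l] v] l']; rewrite /mmulT /=.
  have [<-|nv] := eqVneq; last first.
    rewrite big_nil -meval_pl -(lf_rt fam) mulA -[amul _ (p v)]mulA.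
    by rewrite (lf_orth fam) // amul0 amul0r.
  rewrite big_seq1 /meval /= foldr_rcons (lf_st fam).
  elim: l' => [|f l' IH] /=; first exact: (lf_rt fam).
  by rewrite mulA IH.
rewrite {1}/meval /= mulA (lf_ck1 fam).
case: eqP => [_|_] /=; last by rewrite amul0r big_nil.
by rewrite (mmulP_meval (src e) (l, v, l')).
Qed.

Lemma eval_flift g la (a : A) :
  (forall m, amul a (meval m) = \sum_(m' <- g m) meval m') ->
  eval (flift g la) = amul a (eval la).
Proof.
move=> h; rewrite /eval (sum_flift meval) amul_sumr; apply: eq_bigr => q _.
by rewrite (amulZr (amulP A)) h.
Qed.

Lemma eval_fmulm m la : eval (fmulm m la) = amul (meval m) (eval la).
Proof.
case: m => [[l v] l']; rewrite /fmulm /=; elim: l => [|e l IH] /=; last first.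
  rewrite (eval_flift _ (mmulS_meval e)) IH mulA.
  by rewrite /meval.
elim: l' la => [|e l' IH] la /=; first
  by rewrite (eval_flift _ (mmulP_meval v)).
by rewrite IH (eval_flift _ (mmulT_meval e)) mulA.
Qed.

Lemma eval_fscale c la : eval (fscale c la) = c *: eval la.
Proof.
by rewrite /eval big_map scaler_sumr; apply: eq_bigr => q _; rewrite scalerA.
Qed.

Lemma eval_cat la lb : eval (la ++ lb) = eval la + eval lb.
Proof. by rewrite /eval big_cat. Qed.

Lemma eval_fmul la lb : eval (fmul la lb) = amul (eval la) (eval lb).
Proof.
rewrite /fmul {1}/eval big_flatten big_map amul_suml; apply: eq_bigr => q _.
rewrite (amulZl (amulP A)) -eval_fmulm /eval big_map scaler_sumr.
by apply: eq_bigr => r _ /=; rewrite scalerA.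
Qed.

End Evaluation.

(** * Normal forms *)

Section NormalForm.
Variables (E : digraph).
Hypotheses (rfE : row_finite E) (nsE : no_sources E).
Local Notation X := (nat -> edge E).
Local Notation monomial := (monomial E).
Implicit Types (x y z : X) (e f : edge E) (l : seq (edge E)) (v w : vert E).
Implicit Types (m : monomial).

Definition edges_at v : seq (edge E) :=
  finmap.enum_fset (fset_set (edges_into v)).

Lemma mem_edges_at e v : (e \in edges_at v) = (rng e == v).
Proof.
rewrite /edges_at in_fset_set; last exact: rfE.
by apply/idP/eqP => [/set_mem|h]; [|apply/mem_set].
Qed.

(** This is where the absence of sources is used: every vertex is the range of
    an infinite path, so that the sets Z(mu, nu) are not empty. *)
Lemma path_from v : exists z, is_path z /\ rng (z 0%N) = v.
Proof.
have /choice[g gP] w : exists e : edge E, rng e = w.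
  by have [e] := nsE w; exists e.
exists (fun n => g (iter n (fun u => src (g u)) v)); split => //.
by apply/asboolP => n; rewrite [RHS]gP iterS.
Qed.

Fixpoint chain l v : bool :=
  if l is e :: l' then (path_range l' v == src e) && chain l' v else true.

Lemma is_path_chain l v z :
  is_path z -> rng (z 0%N) = v -> is_path (scat l z) = chain l v.
Proof.
move=> pz rz; elim: l => //= e l <-.
by rewrite is_path_scons eq_sym; congr (_ && _); case: l => //=; rewrite rz.
Qed.

Lemma msupp_exists m : chain m.1.1 m.1.2 -> chain m.2 m.1.2 ->
  exists x k y, msupp m x k y.
Proof.
move=> c c'; have [z [pz rz]] := path_from m.1.2.
exists (scat m.1.1 z), (mdegree m), (scat m.2 z); apply/msuppP.
by exists z; do !split => //; rewrite (is_path_chain _ pz rz).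
Qed.

(** One step of the relation p_v = sum s_e s_e^*, applied in the middle of the
    monomial. *)
Definition refine1 m : seq monomial :=
  [seq (rcons m.1.1 e, src e, rcons m.2 e) | e <- edges_at m.1.2].

Fixpoint refine n m : seq monomial :=
  if n is n'.+1 then flatten [seq refine n' m' | m' <- refine1 m] else [:: m].

Lemma size_refine n m m' : m' \in refine n m -> size m'.2 = (size m.2 + n)%N.
Proof.
elim: n m => [|n IH] m /=; first by rewrite inE addn0 => /eqP ->.
move=> /flatten_mapP[m1 /mapP[e _ ->]] /IH -> /=.
by rewrite size_rcons addSnnS.
Qed.

Lemma sum_refine (V : nmodType) (F : monomial -> V) n m :
  (forall m', F m' = \sum_(m1 <- refine1 m') F m1) ->
  \sum_(m' <- refine n m) F m' = F m.
Proof.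
move=> h; elim: n m => [|n IH] m /=; first by rewrite big_seq1.
by rewrite big_flatten big_map /= [RHS]h; apply: eq_bigr => m' _; exact: IH.
Qed.

Lemma msupp_refine1 (S : comPzRingType) m x k y :
  (msupp m x k y)%:R = \sum_(m' <- refine1 m) (msupp m' x k y)%:R :> S.
Proof.
rewrite /refine1 big_map.
have sub e : e \in edges_at m.1.2 ->
    msupp (rcons m.1.1 e, src e, rcons m.2 e) x k y ->
    msupp m x k y /\ e = x (size m.1.1).
  rewrite mem_edges_at => /eqP re /msuppP[z /= [[-> -> rz] [px py ek]]].
  split; last first.
    rewrite scat_rcons; elim: {px py} m.1.1 => //=.
  apply/msuppP; exists (scons e z); rewrite -!scat_rcons; do !split => //.
  by rewrite ek /mdegree /= !size_rcons; lia.
case: (boolP (msupp m x k y)) => [|nm]; last first.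
  rewrite big_seq big1 // => e ie; case c : msupp => //.
  by have [] := sub _ ie c; rewrite (negbTE nm).
move=> /msuppP[z [[xz yz rz] [px py ek]]].
have z0 : z 0%N \in edges_at m.1.2 by rewrite mem_edges_at rz.
rewrite (bigD1_seq (z 0%N)) //=; last exact: finmap.fset_uniq.
rewrite big_seq_cond big1 ?addr0 => [|e /andP[ie ne]]; last first.
  case c : msupp => //; have [_ ee] := sub _ ie c; move: ne; rewrite ee xz.
  by elim: {xz yz ek rz z0 sub ie c ee} m.1.1 => [|? ? ?] /=; rewrite ?eqxx.
suff -> : msupp (rcons m.1.1 (z 0%N), src (z 0%N), rcons m.2 (z 0%N)) x k y
  by [].
apply/msuppP; exists (shift z); rewrite /= !scat_rcons !scons_eta;
  do !split => //.
  by apply/esym/is_path_src; apply: (@is_path_scat _ m.1.1); rewrite -xz.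
by rewrite ek /mdegree /= !size_rcons; lia.
Qed.

Section Collect.
Variables (S : comPzRingType) (A : algebra S).
Variables (p : vert E -> A) (s t : edge E -> A).
Hypothesis fam : leavitt_family p s t.
Local Notation mulA := (amulA (amulP A)).
Local Notation meval := (meval p s t).
Local Notation eval := (eval p s t).
Implicit Types (la lb : seq (S * monomial)).

Lemma meval_refine1 m : meval m = \sum_(m' <- refine1 m) meval m'.
Proof.
case: m => [[l v] l']; rewrite /refine1 big_map /=.
pose T a := foldr (fun e a => amul a (t e)) a l'.
have TM e a : T (amul (s e) a) = amul (s e) (T a).
  by rewrite /T; elim: (l') => //= f l1 ->; rewrite mulA.
have Tsum (r : seq (edge E)) (F : edge E -> A) :
    T (\sum_(e <- r) F e) = \sum_(e <- r) T (F e).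
  by rewrite /T; elim: (l') => //= f l1 ->; rewrite amul_suml.
have -> : meval (l, v, l') = foldr (fun e a => amul (s e) a) (T (p v)) l by [].
rewrite (lf_ck2 fam) fsbig_finite; last exact: rfE.
rewrite Tsum (eq_bigr _ (fun e _ => TM e (t e))) -/(edges_at v).
elim: l => [|f l IH] /=.
  by apply: eq_bigr => e _; rewrite /meval /= foldr_rcons (lf_st fam).
by rewrite IH amul_sumr; apply: eq_bigr => e _.
Qed.

Lemma meval_pr v l w : amul (meval ([::], v, l)) (p w) =
  if path_range l v == w then meval ([::], v, l) else 0.
Proof.
case: l => [|e l] /=; rewrite /meval /=.
  by case: eqP => [->|/eqP nv]; [exact: (lf_idem fam)|exact: (lf_orth fam)].
rewrite -mulA; case: eqP => [<-|/eqP nv]; first by rewrite (lf_rt fam).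
by rewrite -(lf_rt fam) -[amul (amul _ _) (p w)]mulA
  (lf_orth fam) // !amul0.
Qed.

Lemma meval_chain m : ~~ (chain m.1.1 m.1.2 && chain m.2 m.1.2) -> meval m = 0.
Proof.
case: m => [[l v] l'] /=; rewrite negb_and => /orP[c|c].
  elim: l c => //= e l IH; rewrite negb_and => /orP[c|/IH h]; last first.
    by rewrite /meval /= -[foldr _ _ _]/(meval (l, v, l')) h amul0.
  rewrite /meval /= -[foldr _ _ _]/(meval (l, v, l')) -(lf_ss fam) -mulA.
  by rewrite (mmulP_meval fam) /mmulP /= (negbTE c) big_nil amul0.
have h : meval ([::], v, l') = 0.
  elim: l' c => //= e l' IH; rewrite negb_and => /orP[c|/IH h]; last first.
    by rewrite /meval /= -[foldr _ _ _]/(meval ([::], v, l')) h amul0r.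
  rewrite /meval /= -[foldr _ _ _]/(meval ([::], v, l')) -(lf_st fam) mulA.
  by rewrite meval_pr (negbTE c) amul0r.
by rewrite meval_amul h; elim: l => //= e l ->; rewrite amul0.
Qed.

Definition frefine N la := flift (fun m => refine (N - size m.2) m) la.

Definition fcollect la : seq (S * monomial) :=
  [seq (\sum_(q <- la | q.2 == m) q.1, m) | m <- undup (map snd la)].

Lemma sum_fcollect (V : lmodType S) (F : monomial -> V) la :
  \sum_(q <- fcollect la) q.1 *: F q.2 = \sum_(q <- la) q.1 *: F q.2.
Proof.
rewrite [RHS](sum_fibers _ snd) big_map; apply: eq_bigr => m _ /=.
by rewrite scaler_suml; apply: eq_bigr => q /eqP ->.
Qed.

(** With second paths of equal lengths the supports of distinct monomials are
    disjoint and non-empty, so the coefficients can be read off the function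
    on the groupoid. *)
Definition normal N la := [/\ uniq (map snd la) &
  forall q, q \in la -> [/\ q.1 != 0, size q.2.2 = N &
    exists x k y, msupp q.2 x k y]].

(** Refine all monomials to the largest length that occurs, collect equal ones,
    and drop those that vanish. *)
Lemma normal_form la : exists N lb, [/\ normal N lb,
  gcoef lb = gcoef la & eval lb = eval la].
Proof.
pose N := \max_(q <- la) size q.2.2.
pose lb := frefine N la.
have sb q : q \in lb -> size q.2.2 = N.
  move=> /flatten_mapP[r rla /mapP[m /size_refine ms ->]] /=.
  by rewrite ms subnKC // /N (big_rem r) //= leq_maxl.
pose ok (q : S * monomial) := (q.1 != 0) &&
  (chain q.2.1.1 q.2.1.2 && chain q.2.2 q.2.1.2).
exists N, [seq q <- fcollect lb | ok q]; split.
- split=> [|q].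
    apply: (@subseq_uniq _ _ (map snd (fcollect lb))).
      exact/map_subseq/filter_subseq.
    by rewrite /fcollect -map_comp map_id_in ?undup_uniq.
  rewrite mem_filter => /andP[/and3P[q0 c c'] /mapP[m]].
  rewrite mem_undup => /mapP[r /sb rN em] eq; split => //.
    by rewrite eq em.
  exact: msupp_exists.
- apply/funext => x; apply/funext => k; apply/funext => y.
  pose F m : S^o := (msupp m x k y)%:R.
  transitivity (\sum_(q <- fcollect lb) q.1 *: F q.2).
    rewrite /gcoef big_filter big_mkcond; apply: eq_bigr => q _.
    case: ifPn => //; rewrite /ok negb_and negbK => /orP[/eqP ->|c].
      by rewrite scale0r.
    rewrite /F; case: msuppP; rewrite ?scaler0 // =>
      -[z [[xz yz rz] [px py _]]].
    have pz : is_path z by apply: (@is_path_scat _ q.2.1.1); rewrite -xz.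
    by move: c; rewrite -!(is_path_chain _ pz rz) -xz -yz px py.
  rewrite sum_fcollect /lb /frefine sum_flift; apply: eq_bigr => q _.
  by rewrite sum_refine // => m; exact: msupp_refine1.
- transitivity (eval (fcollect lb)).
    rewrite /eval big_filter big_mkcond; apply: eq_bigr => q _.
    case: ifPn => //; rewrite /ok negb_and negbK =>
      /orP[/eqP ->|/meval_chain ->].
      by rewrite scale0r.
    by rewrite scaler0.
  rewrite /eval sum_fcollect /lb /frefine sum_flift; apply: eq_bigr => q _.
  by rewrite sum_refine // => m; exact: meval_refine1.
Qed.

Lemma normal_gcoef N lb q x k y :
  normal N lb -> q \in lb -> msupp q.2 x k y -> gcoef lb x k y = q.1.
Proof.
move=> [ub hb] qb c; rewrite /gcoef (bigD1_seq q) ?(map_uniq ub) //= c mulr1.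
rewrite big_seq_cond big1 ?addr0 // => r /andP[rb rq].
case c' : msupp; last by rewrite mulr0.
case/negP: rq; apply/eqP.
have rq2 : r.2 = q.2.
  by apply: msupp_inj c' c; have [_ -> _] := hb _ rb; have [_ -> _] := hb _ qb.
exact: (uniq_map_inj ub rb qb rq2).
Qed.

Lemma normal_supp N lb x k y : normal N lb -> gcoef lb x k y != 0 ->
  exists2 q, q \in lb & msupp q.2 x k y.
Proof.
move=> _ nz; apply: contrapT => h; case/negP: nz; apply/eqP.
rewrite /gcoef big_seq big1 // => q qb; case c : msupp; last by rewrite mulr0.
by case: h; exists q.
Qed.

Lemma gcoef_eq0_eval la : (forall x k y, gcoef la x k y = 0) -> eval la = 0.
Proof.
move=> h; have [N [lb [nb eb <-]]] := normal_form la.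
case: lb nb eb => [|q lb] nb eb; first by rewrite /eval big_nil.
have [_ /(_ q)] := nb; rewrite inE eqxx => /(_ isT)[q0 _ [x [k [y c]]]].
by move: q0; rewrite -(normal_gcoef nb _ c) ?inE ?eqxx // eb h eqxx.
Qed.

(** The value of a formal sum factors through its function on the groupoid.
    This is the universal property of the algebra of these functions. *)
Lemma eq_gcoef_eval la lb : gcoef la = gcoef lb -> eval la = eval lb.
Proof.
move=> h; apply/eqP; rewrite -subr_eq0 -scaleN1r -eval_fscale -eval_cat;
  apply/eqP.
by apply: gcoef_eq0_eval => x k y; rewrite gcoef_cat gcoef_fscale h mulN1r
  subrr.
Qed.

End Collect.

End NormalForm.

Section Hom.
Variables (E : digraph) (S : comPzRingType) (A B : algebra S) (f : A -> B).
Variables (p : vert E -> A) (s t : edge E -> A).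
Hypothesis fhom : algebra_hom f.

Lemma hom_meval m :
  f (meval p s t m) = meval (f \o p) (f \o s) (f \o t) m.
Proof.
have [_ fM] := fhom; case: m => [[l v] l']; rewrite /meval /=.
elim: l => [|e l IH] /=; last by rewrite fM IH.
by elim: l' => //= e l' IH; rewrite fM IH.
Qed.

Lemma hom_eval la : f (eval p s t la) = eval (f \o p) (f \o s) (f \o t) la.
Proof.
have [fl _] := fhom; pose g := GRing.isLinear.Build _ _ _ _ f fl.
pose h : {linear A -> B} := HB.pack f g.
rewrite -[f]/(h : A -> B) linear_sum; apply: eq_bigr => q _.
by rewrite linearZ /= hom_meval.
Qed.

End Hom.

(** * The algebra of functions on the path groupoid *)

Section Steinberg.
Variables (E : digraph) (S : comPzRingType).
Local Notation X := (nat -> edge E).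
Local Notation monomial := (monomial E).
Local Notation gfun := (X -> int -> X -> S^o).
Implicit Types (la lb : seq (S * monomial)).

Definition stein_pred : {pred gfun} := fun f => `[< exists la, f = gcoef la >].

Lemma stein_closed : submod_closed stein_pred.
Proof.
split=> [|c f g /asboolP[la ->] /asboolP[lb ->]]; apply/asboolP.
  by exists [::]; do 3!apply/funext => ?; rewrite /gcoef big_nil.
exists (fscale c la ++ lb); apply/funext => x; apply/funext => k.
by apply/funext => y; rewrite gcoef_cat gcoef_fscale.
Qed.

HB.instance Definition _ :=
  GRing.isSubmodClosed.Build S gfun stein_pred stein_closed.

Record stein := Stein { stein_val : gfun; stein_in : stein_val \in stein_pred }.
HB.instance Definition _ := [isSub for stein_val].
HB.instance Definition _ := [Choice of stein by <:].
HB.instance Definition _ := [SubChoice_isSubLmodule of stein by <:].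
Implicit Types F G H : stein.

Definition stein_of la : stein := Stein (asboolT (ex_intro _ la erefl)).

(** The product is defined with a chosen formal sum for each function; the
   action shows that it does not depend on the choice. *)
Definition stein_list F : seq (S * monomial) :=
  projT1 (cid (asboolW (stein_in F))).

Lemma stein_listE F : gcoef (stein_list F) = stein_val F.
Proof. by rewrite /stein_list; case: cid. Qed.

Definition stein_act F := act (stein_list F).

Lemma stein_act_of la : stein_act (stein_of la) = act la.
Proof. by apply: eq_gcoef_act; rewrite stein_listE. Qed.

Lemma stein_act_inj F G : stein_act F = stein_act G -> F = G.
Proof.
move=> h; apply: val_inj => /=; rewrite -!stein_listE.
by do 3!apply/funext => ?; rewrite -!act_delta -/(stein_act F) h.
Qed.

Lemma stein_actD F G xi x k :
  stein_act (F + G) xi x k = stein_act F xi x k + stein_act G xi x k.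
Proof.
rewrite -act_cat; apply: (congr1 (fun a => a xi x k)); apply: eq_gcoef_act.
by do 3!apply/funext => ?; rewrite gcoef_cat !stein_listE.
Qed.

Lemma stein_actZ c F xi x k :
  stein_act (c *: F) xi x k = c * stein_act F xi x k.
Proof.
rewrite -act_fscale; apply: (congr1 (fun a => a xi x k)); apply: eq_gcoef_act.
by do 3!apply/funext => ?; rewrite gcoef_fscale !stein_listE.
Qed.

Lemma stein_act0 xi x k : stein_act 0 xi x k = 0.
Proof. by rewrite -(scale0r 0) stein_actZ mul0r. Qed.

Lemma stein_act_sum I (r : seq I) (H : I -> stein) xi x k :
  stein_act (\sum_(i <- r) H i) xi x k = \sum_(i <- r) stein_act (H i) xi x k.
Proof.
apply: (big_morph (fun F => stein_act F xi x k)); last exact: stein_act0.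
by move=> F G; exact: stein_actD.
Qed.

Definition stein_mul F G : stein :=
  stein_of (fmul (stein_list F) (stein_list G)).

Lemma stein_actM F G xi :
  stein_act (stein_mul F G) xi = stein_act F (stein_act G xi).
Proof. by rewrite /stein_mul stein_act_of act_fmul. Qed.

Lemma act_lin la c (xi xi' : X -> int -> S) x k :
  act la (fun y j => c * xi y j + xi' y j) x k =
    c * act la xi x k + act la xi' x k.
Proof.
rewrite /act mulr_sumr -big_split; apply: eq_bigr => q _ /=.
rewrite /mact /pull; case: ifP => _; last by rewrite !mulr0 addr0.
by rewrite mulrDr !mulrA [q.1 * c]mulrC.
Qed.

Lemma stein_algebra_mul : algebra_mul stein_mul.
Proof.
split.
- by move=> F G H; apply: stein_act_inj; apply/funext => xi;
  rewrite !stein_actM.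
- move=> F G H; apply: stein_act_inj; do 3!apply/funext => ?.
  by rewrite !(stein_actM, stein_actD).
- move=> F G H; apply: stein_act_inj; apply/funext => xi.
  apply/funext => x; apply/funext => k; rewrite stein_actD !stein_actM.
  transitivity
    (stein_act F (fun y j => 1 * stein_act G xi y j + stein_act H xi y j) x k).
    congr (act _ _ _ _); do 2!apply/funext => ?.
    by rewrite stein_actD mul1r.
  by rewrite [LHS]act_lin mul1r.
- move=> c F G; apply: stein_act_inj; do 3!apply/funext => ?.
  by rewrite !(stein_actM, stein_actZ).
- move=> c F G; apply: stein_act_inj; apply/funext => xi.
  apply/funext => x; apply/funext => k.
  rewrite !(stein_actM, stein_actZ).
  rewrite -[RHS]addr0 -[X in _ + X](stein_act0 (stein_act G xi) x k).
  transitivity (stein_act F (fun y j => c * stein_act G xi y j + 0) x k).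
    congr (act _ _ _ _); do 2!apply/funext => ?.
    by rewrite stein_actZ addr0.
  rewrite [LHS]act_lin; congr (_ + _); rewrite stein_act0 /act big1 // => q _.
  by rewrite /mact /pull if_same mulr0.
Qed.

Definition stein_algebra : algebra S := Algebra stein_algebra_mul.

Definition stein_p (v : vert E) : stein_algebra :=
  stein_of [:: (1, ([::], v, [::]))].
Definition stein_s (e : edge E) : stein_algebra :=
  stein_of [:: (1, ([:: e], src e, [::]))].
Definition stein_t (e : edge E) : stein_algebra :=
  stein_of [:: (1, ([::], src e, [:: e]))].

Lemma act1 (m : monomial) (xi : X -> int -> S) : act [:: (1, m)] xi = mact m xi.
Proof. by do 2!apply/funext => ?; rewrite /act big_seq1 mul1r. Qed.

Lemma stein_act_p v : stein_act (stein_p v) = actP v.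
Proof. by rewrite stein_act_of; apply/funext => xi; rewrite act1 mact_vert. Qed.

Lemma stein_act_s e : stein_act (stein_s e) = actS e.
Proof.
rewrite stein_act_of; apply/funext => xi; rewrite act1 mact_consl mact_vert.
apply/funext => x; apply/funext => k; rewrite /actS /actP /pull addr0.
case: ifP => // /andP[px /eqP <-].
by rewrite is_path_shift // is_path_src // eqxx.
Qed.

Lemma stein_act_t e : stein_act (stein_t e) = actT e.
Proof.
rewrite stein_act_of; apply/funext => xi; rewrite act1 mact_consr mact_vert.
apply/funext => x; apply/funext => k; rewrite /actT /actP /pull addr0.
by rewrite [_ == src e]eq_sym; case: (is_path x && _).
Qed.

Hypothesis rfE : row_finite E.

(** The relations are checked on the generators as operators. *)
Lemma stein_family : leavitt_family stein_p stein_s stein_t.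
Proof.
have ext (F G : stein) : (forall xi x k, stein_act F xi x k =
  stein_act G xi x k) ->
    F = G.
  by move=> h; apply: stein_act_inj; do 3!apply/funext => ?; exact: h.
split.
- move=> v; apply: ext => xi x k; rewrite stein_actM !stein_act_p.
  by rewrite /actP /pull !addr0; case: (is_path x && _).
- move=> v w nvw; apply: ext => xi x k;
  rewrite stein_actM !stein_act_p stein_act0.
  rewrite /actP /pull; case: ifP => // /andP[-> /eqP ->].
  by rewrite (negbTE nvw).
- move=> e; apply: ext => xi x k; rewrite stein_actM stein_act_p stein_act_s.
  rewrite /actP /actS /pull addr0; case px: (is_path x) => //=.
  by case: (eqVneq (x 0%N) e) => [->|]; rewrite ?eqxx ?if_same.
- move=> e; apply: ext => xi x k; rewrite stein_actM stein_act_p stein_act_s.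
  rewrite /actP /actS /pull addr0; case: ifP => // /andP[px /eqP <-].
  by rewrite is_path_shift // is_path_src // eqxx.
- move=> e; apply: ext => xi x k; rewrite stein_actM stein_act_p stein_act_t.
  rewrite /actP /actT /pull addr0 [_ == src e]eq_sym.
  by case: (is_path x && _).
- move=> e; apply: ext => xi x k; rewrite stein_actM stein_act_p stein_act_t.
  rewrite /actP /actT /pull addr0; case: ifP => // /andP[px h].
  by rewrite is_path_scons h px eqxx.
- move=> e f; apply: ext => xi x k; rewrite stein_actM stein_act_t stein_act_s.
  rewrite /actT /actS /pull.
  have [ef|ne] := eqVneq e f; last first.
    by rewrite andbF if_same stein_act0.
  subst f; rewrite stein_act_p /actP /pull /= andbT is_path_scons addrK.
  rewrite addr0 [_ == src e]eq_sym.
  by case: (is_path x); case: (src e == rng (x 0%N)).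
- move=> v; apply: ext => xi x k; rewrite fsbig_finite; last exact: rfE.
  rewrite stein_act_sum -/(edges_at v) stein_act_p.
  have term e : stein_act (stein_mul (stein_s e) (stein_t e)) xi x k =
      if is_path x && (x 0%N == e) then xi x k else 0.
    rewrite stein_actM stein_act_s stein_act_t /actS /actT /pull subrK.
    case: ifP => // /andP[px /eqP <-].
    by rewrite is_path_shift // is_path_src // eqxx scons_eta.
  rewrite (eq_bigr _ (fun e _ => term e)) /actP /pull addr0.
  case px: (is_path x) => /=; last by rewrite big1.
  case: eqP => [rx|nx].
    rewrite (bigD1_seq (x 0%N)) ?mem_edges_at ?rx ?finmap.fset_uniq //= eqxx.
    by rewrite big1 ?addr0 // => e; rewrite eq_sym => /negbTE ->.
  rewrite big_seq big1 // => e; rewrite mem_edges_at // => /eqP re.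
  by case: eqP => // xe; case: nx; rewrite xe.
Qed.

End Steinberg.

(** * Groupoid coefficients in a Leavitt path algebra *)

Section Gpath.
Variables (E : digraph) (S : comPzRingType) (A : algebra S).
Variables (p : vert E -> A) (s t : edge E -> A).
Hypothesis fam : leavitt_family p s t.
Local Notation mulA := (amulA (amulP A)).
Local Notation meval := (meval p s t).

Definition gpath_data (mu : gpath E) : seq (edge E) * vert E :=
  match mu with
  | VertexPath v => ([::], v)
  | EdgePath e l _ => (e :: l, src (last e l))
  end.

Lemma chain_gpath l v : chain l v -> exists mu, gpath_data mu = (l, v).
Proof.
case: l => [|e l] c; first by exists (VertexPath v).
suff [pl <-] : path (fun f g => src f == rng g) e l /\ src (last e l) = v.
  by exists (EdgePath pl).
elim: l e c => [|f l IH] e /=; first by rewrite andbT => /eqP.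
by move=> /andP[/eqP <- /IH[-> ->]]; rewrite eqxx.
Qed.

Lemma gpath_meval mu nu :
  (gpath_data mu).2 = (gpath_data nu).2 ->
  amul (gpath_elt amul p s mu) (gpath_ghost amul p t nu) =
  meval ((gpath_data mu).1, (gpath_data mu).2, (gpath_data nu).1).
Proof.
have elt a e l : amul a (p (src e)) = a -> foldl (fun x f => amul x (s f)) a l =
    amul a (foldr (fun e a => amul (s e) a) (p (src (last e l))) l).
  elim: l a e => [|f l IH] a e h //=.
  by rewrite (IH _ f) ?mulA // -mulA (lf_ss fam).
have ghost a e l : amul (p (src e)) a = a ->
  foldl (fun x f => amul (t f) x) a l =
    amul (foldr (fun e a => amul a (t e)) (p (src (last e l))) l) a.
  elim: l a e => [|f l IH] a e h //=.
  by rewrite (IH _ f) ?mulA // (lf_st fam).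
have -> : gpath_elt amul p s mu = foldr (fun e a => amul (s e) a)
    (p (gpath_data mu).2) (gpath_data mu).1.
  by case: mu => //= e l _; rewrite (elt _ e) // (lf_ss fam).
have -> : gpath_ghost amul p t nu =
  meval ([::], (gpath_data nu).2, (gpath_data nu).1).
  by case: nu => //= e l _; rewrite (ghost _ e) // (lf_st fam).
move=> ->; rewrite [RHS]meval_amul.
by elim: (_.1) => [|e l IH] /=; [exact: meval_pl | rewrite -mulA IH].
Qed.

End Gpath.

Section Leavitt.
Variables (E : digraph).
Hypotheses (rfE : row_finite E) (nsE : no_sources E).
Variables (R : comPzRingType) (conjR : {rmorphism R -> R}).
Variable (L : leavitt_algebra conjR E).
Local Notation X := (nat -> edge E).
Local Notation monomial := (monomial E).
Local Notation gen_p := (@la_p _ _ _ L).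
Local Notation gen_s := (@la_s _ _ _ L).
Local Notation gen_t := (@la_t _ _ _ L).
Implicit Types (a b d : L) (c : R) (x y z : X).

Definition lmono (m : monomial) : L := meval gen_p gen_s gen_t m.
Definition leval (la : seq (R * monomial)) : L := eval gen_p gen_s gen_t la.

Definition to_stein : L -> stein_algebra E R :=
  projT1 (cid (la_universal L (stein_family R rfE))).

Lemma to_steinP : algebra_hom to_stein /\
  [/\ forall v, to_stein (gen_p v) = stein_p R v,
      forall e, to_stein (gen_s e) = stein_s R e &
      forall e, to_stein (gen_t e) = stein_t R e].
Proof. by rewrite /to_stein; case: cid => f []. Qed.

Lemma stein_meval (m : monomial) :
  stein_act (meval (stein_p R) (stein_s R) (stein_t R) m) = mact m.
Proof.
case: m => [[l v] l']; apply/funext => xi; elim: l xi => [|e l IH] xi;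
  last first.
  rewrite -[meval _ _ _ _]/(stein_mul (stein_s R e)
    (meval (stein_p R) (stein_s R) (stein_t R) (l, v, l'))).
  by rewrite stein_actM stein_act_s IH mact_consl.
elim: l' xi => [|e l' IH] xi.
  by rewrite -[meval _ _ _ _]/(stein_p R v) stein_act_p mact_vert.
rewrite -[meval _ _ _ _]/(stein_mul
  (meval (stein_p R) (stein_s R) (stein_t R) ([::], v, l')) (stein_t R e)).
by rewrite stein_actM stein_act_t IH mact_consr.
Qed.

Lemma to_stein_eval la : to_stein (leval la) = stein_of la.
Proof.
have [fhom [fp fs ft]] := to_steinP.
rewrite /leval (hom_eval _ _ _ fhom).
have -> : to_stein \o gen_p = stein_p R by apply/funext.
have -> : to_stein \o gen_s = stein_s R by apply/funext.
have -> : to_stein \o gen_t = stein_t R by apply/funext.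
apply: stein_act_inj; rewrite stein_act_of; do 3!apply/funext => ?.
rewrite /eval stein_act_sum; apply: eq_bigr => q _.
by rewrite stein_actZ stein_meval.
Qed.

(** Evaluating a formal sum of the image of a is a homomorphism that fixes the
    generators, hence the identity. So the monomials span, and the map to
    functions on the groupoid is injective. *)
Lemma eval_to_stein a : a = leval (stein_list (to_stein a)).
Proof.
have fam := la_family L; have [fhom [fp fs ft]] := to_steinP.
pose h a := leval (stein_list (to_stein a)).
have eval_of la : leval (stein_list (stein_of la)) = leval la.
  by apply: (eq_gcoef_eval rfE nsE fam); rewrite stein_listE.
have hev la : h (leval la) = leval la by rewrite /h to_stein_eval eval_of.
have [f0 [_ uf]] := la_universal L fam.
have fid : f0 = id by exact: uf.
suff fh : f0 = h by rewrite -[RHS]/(h a) -fh fid.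
apply: uf; split.
  split=> [c b b'|b b']; rewrite /h.
    have [fl _] := fhom; rewrite fl /leval -eval_fscale -eval_cat.
    apply: (eq_gcoef_eval rfE nsE fam); rewrite stein_listE /=.
    by do 3!apply/funext => ?; rewrite gcoef_cat gcoef_fscale !stein_listE.
  have [_ fM] := fhom; rewrite fM /leval -(eval_fmul fam) -/(leval _) eval_of.
  by [].
have ev1 m : leval [:: (1, m)] = lmono m by rewrite /leval /eval big_seq1
  scale1r.
have hm m : h (lmono m) = lmono m by rewrite -ev1 hev.
split=> [v|e|e].
- exact: (hm ([::], v, [::])).
- by have := hm ([:: e], src e, [::]); rewrite /lmono /meval /= (lf_ss fam).
- by have := hm ([::], src e, [:: e]); rewrite /lmono /meval /= (lf_st fam).
Qed.

Definition coef a : X -> int -> X -> R := stein_val (to_stein a).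

Lemma coef_eval la : coef (leval la) = gcoef la.
Proof. by rewrite /coef to_stein_eval. Qed.

Lemma eval_spans a : exists la, a = leval la.
Proof. by eexists; exact: eval_to_stein. Qed.

Lemma coef_inj : injective coef.
Proof.
move=> a b; have [la ->] := eval_spans a; have [lb ->] := eval_spans b.
by rewrite !coef_eval; apply: (eq_gcoef_eval rfE nsE (la_family L)).
Qed.

Lemma coef_meval m x k y : coef (lmono m) x k y = (msupp m x k y)%:R.
Proof.
have -> : lmono m = leval [:: (1, m)] by rewrite /leval /eval big_seq1 scale1r.
by rewrite coef_eval /gcoef big_seq1 mul1r.
Qed.

Lemma coefD a b x k y : coef (a + b) x k y = coef a x k y + coef b x k y.
Proof.
have [la ->] := eval_spans a; have [lb ->] := eval_spans b.
by rewrite /leval -eval_cat !coef_eval gcoef_cat.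
Qed.

Lemma coefZ c a x k y : coef (c *: a) x k y = c * coef a x k y.
Proof.
have [la ->] := eval_spans a.
by rewrite /leval -eval_fscale !coef_eval gcoef_fscale.
Qed.

Lemma coef0 x k y : coef 0 x k y = 0.
Proof. by rewrite -(scale0r 0) coefZ mul0r. Qed.

Lemma coef_sum I (r : seq I) (F : I -> L) x k y :
  coef (\sum_(i <- r) F i) x k y = \sum_(i <- r) coef (F i) x k y.
Proof.
apply: (big_morph (fun a => coef a x k y)); last exact: coef0.
by move=> a b; exact: coefD.
Qed.

Lemma coef_row a x : exists s : seq (int * X)%type, [/\ uniq s,
  forall k y, (k, y) \notin s -> coef a x k y = 0 &
  forall b k z, coef (amul a b) x k z =
    \sum_(q <- s) coef a x q.1 q.2 * coef b q.2 (k - q.1) z].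
Proof.
have [la ->] := eval_spans a; have [s [us [s0 h]]] := act_row la x.
exists s; rewrite coef_eval; split=> // b k z; have [lb ->] := eval_spans b.
by rewrite /leval -(eval_fmul (la_family L)) !coef_eval gcoef_fmul h.
Qed.

Lemma star0 : la_star (0 : L) = 0.
Proof.
by apply: (@addrI _ (la_star (0 : L))); rewrite -(@la_starD _ _ _ L) !addr0.
Qed.

Lemma star_sum I (r : seq I) (F : I -> L) :
  la_star (\sum_(i <- r) F i) = \sum_(i <- r) la_star (F i).
Proof. exact: (big_morph _ (@la_starD _ _ _ L) star0). Qed.

Lemma star_meval c m : la_star (c *: lmono m) = conjR c *: lmono (mflip m).
Proof.
have fam := la_family L.
case ch : (chain m.1.1 m.1.2 && chain m.2 m.1.2); last first.
  have e0 : lmono m = 0 by apply: (meval_chain fam); rewrite ch.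
  have e1 : lmono (mflip m) = 0 by apply: (meval_chain fam); rewrite /=
    andbC ch.
  by rewrite e0 e1 !scaler0 star0.
case: m ch => [[l v] l'] /= /andP[/chain_gpath[mu emu] /chain_gpath[nu enu]].
have emn : (gpath_data mu).2 = (gpath_data nu).2 by rewrite emu enu.
have := @la_starZ _ _ _ L c mu nu.
by rewrite (gpath_meval fam emn) (gpath_meval fam (esym emn)) emu enu.
Qed.

Lemma coef_star a x k y : coef (la_star a) x k y = conjR (coef a y (- k) x).
Proof.
have [la ->] := eval_spans a; rewrite coef_eval /leval /eval star_sum coef_sum
  rmorph_sum.
apply: eq_bigr => q _; rewrite star_meval coefZ coef_meval msupp_flip rmorphM
  /=.
by rewrite rmorph_nat.
Qed.

Lemma la_diagP a : la_diag L a <->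
  exists la : seq (R * monomial), a = leval la /\ forall q, q \in la ->
    q.2.1.1 = q.2.2.
Proof.
have fam := la_family L; split=> [[n [c [mu ->]]]|[la [-> h]]].
  exists [seq (c i, ((gpath_data (mu i)).1, (gpath_data (mu i)).2,
                     (gpath_data (mu i)).1)) | i <- enum 'I_n].
  split; last by move=> q /mapP[i _ ->].
  rewrite /leval /eval big_map big_enum /=; apply: eq_bigr => i _.
  by rewrite /la_diag_elt (gpath_meval fam).
have /choice[g gP] (i : 'I_(size la)) : exists cm : R * gpath E,
    (tnth (in_tuple la) i).1 *: lmono (tnth (in_tuple la) i).2 =
    cm.1 *: la_diag_elt L cm.2.
  have := h _ (mem_tnth i (in_tuple la)); case: (tnth _ i) =>
    c [[l v] l'] /= <-.
  case ch : (chain l v).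
    have [mu emu] := chain_gpath ch; exists (c, mu).
    by rewrite /la_diag_elt (gpath_meval fam) // emu.
  exists (0, VertexPath v); rewrite scale0r.
  by rewrite [lmono _](meval_chain fam) ?scaler0 //= ch.
exists (size la), (fun i => (g i).1), (fun i => (g i).2).
by rewrite /leval /eval big_tnth; apply: eq_bigr.
Qed.

Lemma diag_coef a x k y : la_diag L a -> coef a x k y != 0 -> k = 0 /\ x = y.
Proof.
move=> /la_diagP[la [-> h]]; rewrite coef_eval => nz; apply: contrapT => nu.
case/negP: nz; apply/eqP; rewrite /gcoef big_seq big1 // => q ql.
case: msuppP => [[z [[xz yz _] [_ _ ek]]]|_]; last by rewrite mulr0.
by case: nu; rewrite ek /mdegree xz yz (h _ ql) subrr.
Qed.

Lemma diag_meval l v : la_diag L (lmono (l, v, l)).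
Proof.
apply/la_diagP; exists [:: (1, (l, v, l))].
by rewrite /leval /eval big_seq1 scale1r; split=> // q; rewrite inE => /eqP ->.
Qed.

Lemma diag_scale c a : la_diag L a -> la_diag L (c *: a).
Proof.
move=> /la_diagP[la [-> h]]; apply/la_diagP; exists (fscale c la).
by rewrite /leval eval_fscale; split=> // q /mapP[r rl ->] /=; exact: h.
Qed.

Lemma meval_s e m : amul (gen_s e) (lmono m) = lmono (e :: m.1.1, m.1.2, m.2).
Proof. by []. Qed.

Lemma meval_t e m : amul (lmono m) (gen_t e) = lmono (m.1.1, m.1.2, e :: m.2).
Proof.
case: m => [[l v] l']; rewrite /lmono /= ![meval _ _ _ (l, _, _)]meval_amul.
by elim: l => //= f l IH; rewrite -(amulA (amulP L)) IH.
Qed.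

Lemma meval_p m w : amul (lmono m) (gen_p w) =
  if path_range m.2 m.1.2 == w then lmono m else 0.
Proof.
case: m => [[l v] l']; rewrite /lmono /= ![meval _ _ _ (l, _, _)]meval_amul.
elim: l => [|e l IH] /=; first exact: (meval_pr (la_family L)).
by rewrite -(amulA (amulP L)) IH; case: ifP => // _; rewrite amul0.
Qed.

(** With [diag_conj_t], the generators are normalizers of the diagonal, a notion
    that a diagonal-preserving isomorphism transfers. *)
Lemma diag_conj_s e d : la_diag L d ->
  la_diag L (amul (amul (gen_s e) d) (gen_t e)).
Proof.
move=> /la_diagP[la [-> h]]; apply/la_diagP.
exists [seq (q.1, (e :: q.2.1.1, q.2.1.2, e :: q.2.2)) | q <- la]; split;
  last first.
  by move=> q /mapP[r rl ->] /=; rewrite (h _ rl).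
rewrite /leval /eval amul_sumr amul_suml big_map; apply: eq_bigr => q _.
rewrite (amulZr (amulP L)) (amulZl (amulP L)) -/(lmono _) meval_s meval_t.
by [].
Qed.

Lemma diag_conj_t e d : la_diag L d ->
  la_diag L (amul (amul (gen_t e) d) (gen_s e)).
Proof.
have fam := la_family L.
move=> /la_diagP[la [-> h]]; apply/la_diagP.
suff gen (q : R * monomial) : q.2.1.1 = q.2.2 -> exists lb : seq (R * monomial),
    amul (amul (gen_t e) (lmono q.2)) (gen_s e) = leval lb /\
    forall q, q \in lb -> q.2.1.1 = q.2.2.
  elim: la h => [|q la IH] h.
    by exists [::]; rewrite /leval /eval !big_nil amul0 amul0r.
  have [|lb [eb hb]] := IH; first by move=> r rl; apply: h; rewrite inE rl orbT.
  have [|lc [ec hc]] := gen q; first by apply: h; rewrite inE eqxx.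
  exists (fscale q.1 lc ++ lb); split; last first.
    by move=> r; rewrite mem_cat => /orP[/mapP[r' r'l ->]|] /=;
      [exact: hc|exact: hb].
  rewrite /leval eval_cat eval_fscale -/(leval lc) -/(leval lb) -ec -eb.
  rewrite /leval /eval big_cons (amulDr (amulP L)) (amulDl (amulP L)).
  by rewrite (amulZr (amulP L)) (amulZl (amulP L)).
case: q => c [[l v] l'] /= <-.
have key m : mmulT e (l, v, l) = [:: m] ->
    exists l1 v1, m = (l1, v1, e :: l1) /\ path_range l1 v1 = src e.
  rewrite /mmulT /=; case: (l) => [|f l1].
    by case: eqP => // _ [<-]; exists [::], (src e).
  by case: ifP => // /andP[/eqP -> /eqP h1] [<-]; exists l1, v.
rewrite (mmulT_meval fam).
case emm : (mmulT e (l, v, l)) => [|m [|m' r]].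
- by exists [::]; rewrite big_nil amul0r /leval /eval big_nil.
- have [l1 [v1 [-> h1]]] := key _ emm.
  exists [:: (1, (l1, v1, l1))]; split; last by move=> q; rewrite inE =>
    /eqP ->.
  rewrite big_seq1 -/(lmono _) -(meval_t e (l1, v1, l1)) -(amulA (amulP L)).
  rewrite (lf_ck1 fam) eqxx meval_p /= h1 eqxx.
  by rewrite /leval /eval big_seq1 scale1r.
- by move: emm; rewrite /mmulT; case: (l) => [|f l1] /=; case: ifP.
Qed.

End Leavitt.

(** * Normalizers are supported on bisections *)

Lemma seq_max (T : eqType) (s : seq T) (P : T -> Prop) (h : T -> int) :
  (exists2 a, a \in s & P a) ->
  exists a, [/\ a \in s, P a & forall b, b \in s -> P b -> h b <= h a].
Proof.
elim: s => [[]//|a s IH [b]]; rewrite inE => bs Pb.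
have [|ns] := pselect (exists2 a, a \in s & P a).
  move=> /IH[c [cs Pc hc]]; have [Pa|nPa] := pselect (P a); last first.
    exists c; split; rewrite ?inE ?cs ?orbT // => d; rewrite inE.
    by move=> /predU1P[->|]; [|exact: hc].
  have [ac|/ltW ca] := leP (h a) (h c).
    exists c; split; rewrite ?inE ?cs ?orbT // => d; rewrite inE.
    by move=> /predU1P[->|] //; exact: hc.
  exists a; split; rewrite ?inE ?eqxx // => d; rewrite inE.
  by move=> /predU1P[->|] // ds Pd; apply: le_trans ca; exact: hc.
case/predU1P: bs Pb => [->|bs] Pb; last by case: ns; exists b.
exists a; split; rewrite ?inE ?eqxx // => d; rewrite inE.
by move=> /predU1P[->|] // ds Pd; case: ns; exists d.
Qed.

Section Bisection.
Variables (E : digraph).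
Hypotheses (rfE : row_finite E) (nsE : no_sources E).
Variables (R : idomainType) (conjR : {rmorphism R -> R}).
Hypothesis conjRK : involutive conjR.
Variable (L : leavitt_algebra conjR E).
Local Notation X := (nat -> edge E).
Local Notation monomial := (monomial E).
Local Notation coef := (coef rfE).
Local Notation lmono := (lmono L).
Local Notation leval := (leval L).
Implicit Types (a b d n : L) (x y z : X).

Definition src_unique a := forall y x k x' k',
  coef a x k y != 0 -> coef a x' k' y != 0 -> x = x' /\ k = k'.
Definition rng_unique a := forall x y k y' k',
  coef a x k y != 0 -> coef a x k' y' != 0 -> y = y' /\ k = k'.
Definition bisection a := src_unique a /\ rng_unique a.

Lemma conj_eq0 (c : R) : (conjR c == 0) = (c == 0).
Proof.
by apply/eqP/eqP => [h|->]; [rewrite -(conjRK c) h rmorph0|exact: rmorph0].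
Qed.

Lemma coef_mul_neq0 a b x k z : coef (amul a b) x k z != 0 ->
  exists l y, coef a x l y != 0 /\ coef b y (k - l) z != 0.
Proof.
have [s [_ _ ->]] := coef_row rfE nsE a x => nz.
apply: contrapT => h; case/negP: nz; apply/eqP; apply: big1 => q _.
apply/eqP; rewrite mulf_eq0; apply: contrapT => /negP; rewrite negb_or.
by move=> /andP[ha hb]; apply: h; exists q.1, q.2.
Qed.

(** Convolution by a function with at most one non-zero entry in each row has
    a single term. *)
Lemma coef_mul1 a b x l y k z : rng_unique a -> coef a x l y != 0 ->
  coef (amul a b) x k z = coef a x l y * coef b y (k - l) z.
Proof.
move=> ua nz; have [s [us s0 ->]] := coef_row rfE nsE a x.
have ls : (l, y) \in s by apply: contraNT nz => /s0 ->.
rewrite (bigD1_seq (l, y)) //= big1 ?addr0 // => q nq.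
have [->|nz'] := eqVneq (coef a x q.1 q.2) 0; first by rewrite mul0r.
case/negP: nq; case: q nz' => l' y' /= nz'.
by have [-> ->] := ua _ _ _ _ _ nz' nz.
Qed.

Lemma bisection_mul a b : bisection a -> bisection b -> bisection (amul a b).
Proof.
move=> [sa ra] [sb rb]; split=> [z x k x' k'|x z k z' k'].
  move=> /coef_mul_neq0[l [y [ha hb]]] /coef_mul_neq0[l' [y' [ha' hb']]].
  have [yy kk] := sb _ _ _ _ _ hb hb'; rewrite -yy in ha'.
  have [xx ll] := sa _ _ _ _ _ ha ha'.
  by split=> //; move: kk; rewrite ll => /addIr.
move=> /coef_mul_neq0[l [y [ha hb]]] /coef_mul_neq0[l' [y' [ha' hb']]].
have [yy ll] := ra _ _ _ _ _ ha ha'; rewrite -yy in hb'.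
have [zz kk] := rb _ _ _ _ _ hb hb'.
by split=> //; move: kk; rewrite ll => /addIr.
Qed.

Lemma diag_bisection d : la_diag L d -> bisection d.
Proof.
move=> dd; split=> [y x k x' k'|x y k y' k'].
  move=> /(diag_coef dd)[-> ->] /(diag_coef dd)[-> ->].
  by [].
move=> /(diag_coef dd)[-> <-] /(diag_coef dd)[-> <-].
by [].
Qed.

Lemma diag_mul d b x k z : la_diag L d ->
  coef (amul d b) x k z = coef d x 0 x * coef b x k z.
Proof.
move=> dd; have [_ rd] := diag_bisection dd.
have [d0|d0] := eqVneq (coef d x 0 x) 0; last first.
  by rewrite (coef_mul1 _ _ _ rd d0) subr0.
rewrite d0 mul0r; apply/eqP; apply: contrapT =>
  /negP /coef_mul_neq0[l [y [h _]]].
have [l0 xy] := diag_coef dd h.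
by move: h; rewrite l0 -xy d0 eqxx.
Qed.

Lemma mul_diag_supp a d x k z : la_diag L d ->
  coef (amul a d) x k z != 0 -> coef a x k z != 0.
Proof.
move=> dd /coef_mul_neq0[l [y [h h']]].
by have [/eqP + <-] := diag_coef dd h'; rewrite subr_eq0 => /eqP ->.
Qed.

Lemma coef_path a x k y : coef a x k y != 0 -> is_path x /\ is_path y.
Proof.
have [la ->] := eval_spans rfE nsE a; rewrite coef_eval // => nz.
apply: contrapT => h; case/negP: nz; apply/eqP; apply: big1 => q _.
by case: msuppP => [[z [_ [px py _]]]|]; [case: h | rewrite mulr0].
Qed.

Definition stake (N : nat) x : seq (edge E) := mkseq x N.

Lemma scat_stake N x : scat (stake N x) (sdrop N x) = x.
Proof.
elim: N x => // N IH x; rewrite sdropS /stake /mkseq /= (iotaDl 1 0) -map_comp.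
by rewrite -[map _ _]/(stake N (shift x)) IH scons_eta.
Qed.

Lemma scat_lt l x N : (N < size l)%N -> forall y, scat l x N = scat l y N.
Proof. by elim: l N => [|e l IH] [|N] //= h y; exact: IH. Qed.

Lemma scat_stake_eq N y z x : scat (stake N y) z = x ->
  forall i, (i < N)%N -> x i = y i.
Proof.
move=> <- i iN; rewrite -[in RHS](scat_stake N y); apply: scat_lt.
by rewrite size_mkseq.
Qed.

Lemma separate (s : seq (int * X)) y : exists N, forall q z,
  q \in s -> scat (stake N y) z = q.2 -> q.2 = y.
Proof.
suff [N h] : exists N, forall q, q \in s ->
    (forall i, (i < N)%N -> q.2 i = y i) -> q.2 = y.
  by exists N => q z qs /scat_stake_eq; exact: h.
elim: s => [|q s [N IH]]; first by exists 0%N.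
have [M hM] : exists M, (forall i, (i < M)%N -> q.2 i = y i) -> q.2 = y.
  have [->|ne] := eqVneq q.2 y; first by exists 0%N.
  have [i ni] : exists i, q.2 i <> y i.
    by apply/existsNP => h; case/eqP: ne; exact/funext.
  by exists i.+1 => /(_ i (ltnSn i)).
exists (maxn M N) => r; rewrite inE => /predU1P[->|rs] h.
  by apply: hM => i iM; apply: h; rewrite leq_max iM.
by apply: IH => // i iN; apply: h; rewrite leq_max iN orbT.
Qed.

Lemma coef_cylinder N y x :
  coef (lmono (stake N y, rng (y N), stake N y)) x 0 x =
  (is_path x && (x == scat (stake N y) (sdrop N x)) &&
     (rng (sdrop N x 0%N) == rng (y N)))%:R.
Proof.
rewrite coef_meval //; congr ((nat_of_bool _)%:R); apply/msuppP/andP => /=.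
  move=> [z [[ex _ rz] [px _ _]]].
  have -> : sdrop N x = z.
    by rewrite ex -{1}(size_mkseq y N) sdrop_scat.
  by rewrite px rz -ex !eqxx.
move=> [/andP[px /eqP ex] /eqP rx]; exists (sdrop N x); do !split => //.
by rewrite /mdegree subrr.
Qed.

(** Let d be the indicator of a cylinder around y that misses the other sources
    of the germs of n with range xa. The coefficient of n d n^* at the quotient
    of the germs (xa, ka, y) and (xb, kb, y) is a sum over the germs (xa, q, y),
    paired with (xb, q - (ka - kb), y). The first has degree at most ka and the
    second has degree at least kb, so only q = ka contributes. The coefficient
    is therefore a product of non-zero elements of a domain, and n d n^* being
    diagonal forces the quotient to be a unit. *)
Lemma extremal_germs n y xa ka xb kb :
  (forall d, la_diag L d -> la_diag L (amul (amul n d) (la_star n))) ->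
  coef n xa ka y != 0 -> coef n xb kb y != 0 ->
  (forall x k, coef n x k y != 0 -> k <= ka) ->
  (forall x k, coef n x k y != 0 -> kb <= k) -> xa = xb /\ ka = kb.
Proof.
move=> nd na nb ha hb.
have [_ py] := coef_path na.
have [s [us s0 hs]] := coef_row rfE nsE n xa.
(* A cylinder around y without any other source of a germ of n with range xa. *)
have [N sep] := separate s y.
pose d := lmono (stake N y, rng (y N), stake N y).
have dd : la_diag L d by exact: diag_meval.
have := nd _ dd; rewrite -(amulA (amulP L)) => D.
suff nz : coef (amul n (amul d (la_star n))) xa (ka - kb) xb != 0.
  have [/eqP + ->] := diag_coef D nz.
  by rewrite subr_eq0 => /eqP.
have ys : (ka, y) \in s by apply: contraNT na => /s0 ->.
have dy : coef d y 0 y = 1.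
  rewrite coef_cylinder py scat_stake eqxx /= .
  suff -> : sdrop N y 0%N = y N by rewrite eqxx.
  by elim: N {d dd D sep} y {na nb ha hb py hs ys} => // N IH y;
    rewrite sdropS IH.
rewrite hs (bigD1_seq (ka, y)) //= big_seq_cond big1 ?addr0.
  rewrite diag_mul // dy mul1r coef_star // mulf_neq0 // conj_eq0.
  suff -> : - (ka - kb - ka) = kb by [].
  by lia.
move=> q /andP[qs nq]; rewrite diag_mul // coef_star //.
apply/eqP; apply: contrapT => /negP; rewrite !mulf_eq0 !negb_or conj_eq0.
move=> /and3P[n1 dq n2]; case/negP: nq; apply/eqP.
have qy : q.2 = y.
  apply: (sep q (sdrop N q.2) qs).
  apply/eqP; move: dq; rewrite coef_cylinder [q.2 == _]eq_sym.
  by case: (scat _ _ == _); rewrite // andbF /= eqxx.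
move: n1 n2; rewrite qy => /ha q1 /hb q2.
case: q qy q1 q2 {qs dq} => k z /= -> q1 q2; congr pair.
by move: q1 q2; lia.
Qed.

(** The germ of largest degree equals the germ of smallest degree, so all germs
    over y have the same degree, and each of them is extremal. *)
Lemma normalizer_src_unique n :
  (forall d, la_diag L d -> la_diag L (amul (amul n d) (la_star n))) ->
  src_unique n.
Proof.
move=> nd y x k x' k' nx nx'.
have [s [_ s0 _]] := coef_row rfE nsE (la_star n) y.
(* The germs of n over y are listed by the row of y in the matrix of n^*. *)
have insupp z j : coef n z j y != 0 -> (- j, z) \in s.
  by move=> nz; apply: contraNT nz => /s0; rewrite coef_star // opprK => /eqP;
    rewrite conj_eq0.
pose P (q : int * X) := coef n q.2 (- q.1) y != 0.
have exP : exists2 q, q \in s & P q.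
  by exists (- k, x); [exact: insupp|rewrite /P /= opprK].
have [[ka xa] [_ na ha]] := seq_max (fun q => - q.1) exP.
have [[kb xb] [_ nb hb]] := seq_max (fun q => q.1) exP.
have ha' z j : coef n z j y != 0 -> j <= - ka.
  move=> nz; rewrite -[j]opprK; apply: (ha (- j, z)); first exact: insupp.
  by rewrite /P /= opprK.
have hb' z j : coef n z j y != 0 -> - kb <= j.
  move=> nz; rewrite lerNl; apply: (hb (- j, z)); first exact: insupp.
  by rewrite /P /= opprK.
have [_ kk] := extremal_germs nd na nb ha' hb'.
have top z j : coef n z j y != 0 -> j = - ka.
  move=> nz; apply: le_anti; rewrite (ha' _ _ nz).
  by have /= -> := kk; rewrite (hb' _ _ nz).
have all z j : coef n z j y != 0 -> xa = z /\ - ka = j.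
  move=> nz; apply: (extremal_germs nd na nz ha') => z' j' nz'.
  by rewrite (top _ _ nz) (top _ _ nz').
by have [<- <-] := all _ _ nx; have [<- <-] := all _ _ nx'.
Qed.

Lemma star_bisection a : src_unique (la_star a) -> rng_unique a.
Proof.
move=> u x y k y' k' h h'.
by have [||-> /oppr_inj ->] := u x y (- k) y' (- k');
  rewrite ?coef_star // ?opprK ?conj_eq0.
Qed.

Lemma bisection_star a : bisection a -> bisection (la_star a).
Proof.
move=> [sa ra]; split=> [y x k x' k'|x y k y' k'];
  rewrite !coef_star // !conj_eq0.
  by move=> h h'; have [-> /oppr_inj ->] := ra _ _ _ _ _ h h'.
by move=> h h'; have [-> /oppr_inj ->] := sa _ _ _ _ _ h h'.
Qed.

(** * Transport of bisections to other coefficients *)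

Lemma normal_list_ex a : exists la, exists N, normal N la /\ a = leval la.
Proof.
have [lb ->] := eval_spans rfE nsE a.
have [N [la [nla _ ela]]] := normal_form rfE nsE (la_family L) lb.
by exists la, N; split=> //; rewrite /leval ela.
Qed.

Definition normal_list a : seq (R * monomial) :=
  projT1 (cid (normal_list_ex a)).

Lemma normal_listP a : exists N, normal N (normal_list a) /\ a =
  leval (normal_list a).
Proof. by rewrite /normal_list; case: cid. Qed.

Lemma normal_list_coef a q x k y :
  q \in normal_list a -> msupp q.2 x k y -> coef a x k y = q.1.
Proof.
have [N [nN {2}->]] := normal_listP a; rewrite coef_eval.
exact: normal_gcoef nN.
Qed.

Lemma normal_list_supp a x k y :
  (coef a x k y != 0) = has (fun q => msupp q.2 x k y) (normal_list a).
Proof.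
apply/idP/hasP => [|[q qa c]].
  have [N [nN {1}->]] := normal_listP a; rewrite coef_eval.
  exact: normal_supp nN.
rewrite (normal_list_coef qa c); have [N [[_ /(_ q qa)[]]]] := normal_listP a.
by [].
Qed.

Section Transport.
Variables (S : comPzRingType) (A : algebra S).
Variables (p : vert E -> A) (s t : edge E -> A).
Hypothesis fam : leavitt_family p s t.
Local Notation meval := (meval p s t).
Local Notation eval := (eval p s t).

(** Replacing all coefficients of the normal form by 1 turns the function into
   the indicator of its support. *)
Definition supp_list a : seq (S * monomial) :=
  [seq (1, q.2) | q <- normal_list a].

Definition transport a : A := \sum_(q <- normal_list a) meval q.2.

Lemma transport_supp_list a : transport a = eval (supp_list a).
Proof. by rewrite /eval big_map; apply: eq_bigr => q _; rewrite scale1r. Qed.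

Lemma gcoef_supp_list a x k y : gcoef (supp_list a) x k y =
  (coef a x k y != 0)%:R.
Proof.
rewrite /gcoef big_map normal_list_supp; have [N [[uN hN] _]] := normal_listP a.
case: hasP => [[q qa c]|h]; last first.
  rewrite big_seq big1 // => q qa; case c : msupp; last by rewrite mulr0.
  by case: h; exists q.
rewrite (bigD1_seq q) ?(map_uniq uN) //= c mulr1 big_seq_cond big1 ?addr0 //.
move=> r /andP[ra rq]; case c' : msupp; last by rewrite mulr0.
case/negP: rq; apply/eqP; apply: (uniq_map_inj uN) => //.
by apply: msupp_inj c' c; have [_ -> _] := hN _ ra; have [_ -> _] := hN _ qa.
Qed.

(** By [eq_gcoef_eval] the choice of a normal form does not matter. *)
Lemma transport_eq a la : (forall x k y, gcoef la x k y =
  (coef a x k y != 0)%:R) ->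
  transport a = eval la.
Proof.
move=> h; rewrite transport_supp_list; apply: (eq_gcoef_eval rfE nsE fam).
by do 3!apply/funext => ?; rewrite h gcoef_supp_list.
Qed.

Lemma transport_ext a b : (forall x k y, (coef a x k y != 0) =
  (coef b x k y != 0)) ->
  transport a = transport b.
Proof.
by move=> h; rewrite (transport_supp_list b); apply: transport_eq => x k y;
  rewrite gcoef_supp_list h.
Qed.

Lemma transport0 : transport 0 = 0.
Proof.
rewrite (@transport_eq 0 [::]) ?/eval ?big_nil // => x k y.
by rewrite /gcoef big_nil coef0 // eqxx.
Qed.

Lemma transport_meval m : transport (lmono m) = meval m.
Proof.
rewrite (@transport_eq _ [:: (1, m)]) => [|x k y].
  by rewrite /eval big_seq1 scale1r.
by rewrite /gcoef big_seq1 mul1r coef_meval; case: msupp;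
  rewrite ?oner_eq0 ?eqxx.
Qed.

Lemma transportD a b : (forall x k y, coef a x k y != 0 -> coef b x k y = 0) ->
  transport (a + b) = transport a + transport b.
Proof.
move=> h; rewrite !transport_supp_list -eval_cat -transport_supp_list;
  apply: transport_eq => x k y.
rewrite gcoef_cat !gcoef_supp_list coefD //.
have [->|a0] := eqVneq (coef a x k y) 0; first by rewrite !add0r.
by rewrite (h _ _ _ a0) addr0 eqxx a0 addr0.
Qed.

Lemma transport_sum (I : eqType) (r : seq I) (F : I -> L) : uniq r ->
  (forall i j x k y, i \in r -> j \in r -> i != j ->
     coef (F i) x k y != 0 -> coef (F j) x k y = 0) ->
  transport (\sum_(i <- r) F i) = \sum_(i <- r) transport (F i).
Proof.
elim: r => [|i r IH] /=; first by rewrite !big_nil transport0.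
move=> /andP[ir ur] h; rewrite !big_cons transportD => [|x k y nz].
  by rewrite IH // => j l x k y jr lr; apply: h; rewrite inE ?jr ?lr orbT.
rewrite coef_sum // big_seq big1 // => j jr.
apply: (h i) nz; rewrite ?inE ?eqxx ?jr ?orbT //.
by apply: contraNneq ir => ->.
Qed.

(** The indicator of a product of bisections is the convolution of the
    indicators; over R the support of the product is the product of the
    supports because R is a domain. *)
Lemma transportM a b : bisection a -> bisection b ->
  transport (amul a b) = amul (transport a) (transport b).
Proof.
move=> [_ ra] _; rewrite (transport_supp_list a) (transport_supp_list b)
  -(eval_fmul fam).
apply: transport_eq => x k z; rewrite gcoef_fmul.
have [r [ur [r0 ->]]] := act_row (supp_list a) x.
have [[l [y nz]]|none] :=
    pselect (exists l y, coef a x l y != 0); last first.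
  rewrite big1 => [|q _].
    apply/esym; case: eqP => // /eqP /coef_mul_neq0[l [y [nz _]]].
    by case: none; exists l, y.
  rewrite gcoef_supp_list; case: eqP => [|/eqP nz]; first by rewrite mul0r.
  by case: none; exists q.1, q.2.
rewrite (coef_mul1 _ _ _ ra nz) mulf_eq0 (negbTE nz) /= -gcoef_supp_list.
have single q : q != (l, y) -> gcoef (supp_list a) x q.1 q.2 = 0.
  rewrite gcoef_supp_list => nq; case: eqP => // /eqP nz'; case/negP: nq.
  case: q nz' => l' y' /= nz'.
  by have [-> ->] := ra _ _ _ _ _ nz' nz.
have [lr|nlr] := boolP ((l, y) \in r).
  rewrite (bigD1_seq (l, y)) //= gcoef_supp_list nz mul1r big1 ?addr0 //.
  by move=> q /single ->; rewrite mul0r.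
have := r0 _ _ nlr; rewrite gcoef_supp_list nz => one0.
(* A germ of a that is missing from the list r forces 1 = 0 in S. *)
have all0 (u : S) : u = 0 by rewrite -(mul1r u) -[1]/(true%:R) one0 mul0r.
by rewrite [LHS]all0 [RHS]all0.
Qed.

Lemma transport_star (star : A -> A) : {morph star : a b / a + b} ->
  (forall m, star (meval m) = meval (mflip m)) ->
  forall a, transport (la_star a) = star (transport a).
Proof.
move=> starD starm a.
have star0 : star 0 = 0.
  by apply: (@addrI _ (star 0)); rewrite -starD !addr0.
rewrite {2}/transport (big_morph star starD star0).
rewrite (@transport_eq _ [seq (1, mflip q.2) | q <- normal_list a]) => [|x k y].
  by rewrite /eval big_map; apply: eq_bigr => q _; rewrite scale1r starm.
rewrite coef_star // conj_eq0 // -gcoef_supp_list /gcoef !big_map.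
by apply: eq_bigr => q _; rewrite msupp_flip.
Qed.

End Transport.

End Bisection.

(** * Images of the generators under a diagonal-preserving isomorphism *)

Section Generators.
Variables (E : digraph) (R : comPzRingType) (conjR : {rmorphism R -> R}).
Variable (L : leavitt_algebra conjR E).

Lemma lmono_p v : lmono L ([::], v, [::]) = la_p L v.
Proof. by []. Qed.

Lemma lmono_s e : lmono L ([:: e], src e, [::]) = la_s L e.
Proof. exact: (lf_ss (la_family L)). Qed.

Lemma lmono_t e : lmono L ([::], src e, [:: e]) = la_t L e.
Proof. exact: (lf_st (la_family L)). Qed.

Lemma star_lmono m : la_star (lmono L m) = lmono L (mflip m).
Proof. by have := star_meval L 1 m; rewrite !scale1r rmorph1 scale1r. Qed.

Lemma star_s e : la_star (la_s L e) = la_t L e.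
Proof. by rewrite -lmono_s star_lmono lmono_t. Qed.

Lemma star_t e : la_star (la_t L e) = la_s L e.
Proof. by rewrite -lmono_s -lmono_t star_lmono. Qed.

Lemma star_p v : la_star (la_p L v) = la_p L v.
Proof. by rewrite -lmono_p star_lmono. Qed.

Lemma diag_p v : la_diag L (la_p L v).
Proof. by rewrite -lmono_p; exact: diag_meval. Qed.

Lemma diag_st e : la_diag L (amul (la_s L e) (la_t L e)).
Proof.
rewrite -[la_s L e](lf_ss (la_family L)); apply: diag_conj_s.
exact: diag_p.
Qed.

End Generators.

Section Transfer.
Variables (E F : digraph).
Hypotheses (rfE : row_finite E) (nsE : no_sources E).
Hypotheses (rfF : row_finite F) (nsF : no_sources F).
Variables (R : idomainType) (conjR : {rmorphism R -> R}).
Hypothesis conjRK : involutive conjR.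
Variables (L : leavitt_algebra conjR E) (M : leavitt_algebra conjR F).

(** The conditions are symmetric in the two graphs, so that what is proved for f
    applies to its inverse. *)
Record diag_iso (E F : digraph) (L : leavitt_algebra conjR E)
    (M : leavitt_algebra conjR F) (f : L -> M) (g : M -> L) : Prop := DiagIso {
  di_K : cancel f g;
  di_KV : cancel g f;
  di_D : {morph f : x y / x + y};
  di_M : {morph f : x y / amul x y >-> amul x y};
  di_star : {morph f : x / la_star x};
  di_diag : forall d, la_diag L d -> la_diag M (f d);
  di_diagV : forall d, la_diag M d -> la_diag L (g d) }.

Lemma diag_iso_sym f g : diag_iso f g -> @diag_iso F E M L g f.
Proof.
move=> [fK gK fD fM fs fd gd]; split=> //.
- by move=> x y; apply: (can_inj fK); rewrite fD !gK.
- by move=> x y; apply: (can_inj fK); rewrite fM !gK.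
- by move=> x; apply: (can_inj fK); rewrite fs !gK.
Qed.

Variables (f : L -> M) (g : M -> L).
Hypothesis fg : diag_iso f g.

Lemma di0 : f 0 = 0.
Proof. by apply: (@addrI _ (f 0)); rewrite -(di_D fg) !addr0. Qed.

Lemma di_sum I (r : seq I) (G : I -> L) :
  f (\sum_(i <- r) G i) = \sum_(i <- r) f (G i).
Proof. exact: (big_morph f (di_D fg) di0). Qed.

Lemma bisection_p v : bisection rfF (f (la_p L v)).
Proof. by apply: diag_bisection => //; apply: (di_diag fg); exact: diag_p. Qed.

(** Normalizing the diagonal is expressed with the ring operations, the
    involution and the diagonal, so it is preserved by f. *)
Lemma di_normalizer a :
  (forall d, la_diag L d -> la_diag L (amul (amul a d) (la_star a))) ->
  src_unique rfF (f a).
Proof.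
move=> h; apply: normalizer_src_unique => // d dd.
rewrite -(di_KV fg d) -(di_star fg) -!(di_M fg); apply: (di_diag fg).
by apply: h; apply: (di_diagV fg).
Qed.

Lemma src_unique_s e : src_unique rfF (f (la_s L e)).
Proof.
by apply: di_normalizer => d dd; rewrite star_s; exact: diag_conj_s.
Qed.

Lemma src_unique_t e : src_unique rfF (f (la_t L e)).
Proof.
by apply: di_normalizer => d dd; rewrite star_t; exact: diag_conj_t.
Qed.

Lemma bisection_s e : bisection rfF (f (la_s L e)).
Proof.
split; first exact: src_unique_s.
by apply: star_bisection => //; rewrite -(di_star fg) star_s;
  exact: src_unique_t.
Qed.

Lemma bisection_t e : bisection rfF (f (la_t L e)).
Proof.
split; first exact: src_unique_t.
by apply: star_bisection => //; rewrite -(di_star fg) star_t;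
  exact: src_unique_s.
Qed.

Lemma bisection_lmono m : bisection rfF (f (lmono L m)).
Proof.
case: m => [[l v] l']; rewrite /lmono meval_amul.
have : bisection rfF (f (meval (la_p L) (la_s L) (la_t L) ([::], v, l'))).
  elim: l' => [|e l' IH]; first exact: bisection_p.
  rewrite -[meval _ _ _ _]/(amul (lmono L ([::], v, l')) (la_t L e)) (di_M fg).
  by apply: bisection_mul => //; exact: bisection_t.
elim: l => //= e l IH /IH h; rewrite (di_M fg).
by apply: bisection_mul => //; exact: bisection_s.
Qed.

Section Target.
Variables (S : comPzRingType) (A : algebra S).
Variables (p : vert F -> A) (s t : edge F -> A).
Hypothesis fam : leavitt_family p s t.
Local Notation transport := (transport rfF nsF p s t).

Definition new_p v := transport (f (la_p L v)).
Definition new_s e := transport (f (la_s L e)).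
Definition new_t e := transport (f (la_t L e)).

Lemma transportM2 a b : bisection rfF (f a) -> bisection rfF (f b) ->
  amul (transport (f a)) (transport (f b)) = transport (f (amul a b)).
Proof. by move=> ha hb; rewrite (di_M fg) (transportM nsF fam ha hb). Qed.

(** The multiplicative relations transfer because transport is multiplicative
    on bisections. The summation relation transfers because the elements
    f(s_e s_e^* ) for distinct e are diagonal with product zero, hence have
    disjoint supports. *)
Lemma new_family : leavitt_family new_p new_s new_t.
Proof.
have fmL := la_family L.
have := (bisection_p, bisection_s, bisection_t) => -[[bp bs] bt].
split=> [v|v w nvw|e|e|e|e|e e'|v];
  rewrite /new_p /new_s /new_t ?transportM2 //.
- by rewrite (lf_idem fmL).
- by rewrite (lf_orth fmL) // di0 transport0.
- by rewrite (lf_rs fmL).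
- by rewrite (lf_ss fmL).
- by rewrite (lf_st fmL).
- by rewrite (lf_rt fmL).
- by rewrite (lf_ck1 fmL); case: ifP => // _; rewrite di0 transport0.
rewrite fsbig_finite; last exact: rfE.
rewrite {1}(lf_ck2 fmL) fsbig_finite; last exact: rfE.
rewrite -/(edges_at v) di_sum transport_sum //; last first.
- move=> e e' x k y _ _ nee nz; apply/eqP; apply: contrapT => /negP nz'.
  have dst e1 := di_diag fg (diag_st L e1).
  have [_ re] := diag_bisection rfF (dst e).
  have [k0 xy] := diag_coef (dst e) nz.
  have := coef_mul1 nsF (f (amul (la_s L e') (la_t L e'))) k y re nz.
  rewrite k0 subrr -(di_M fg) -(amulA (amulP L)).
  rewrite [amul (la_t L e) _](amulA (amulP L)) (lf_ck1 fmL) (negbTE nee).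
  rewrite amul0r amul0 di0 coef0 // => /esym/eqP.
  rewrite mulf_eq0; move: nz nz'; rewrite k0 xy => /negbTE -> /negbTE ->.
  by [].
- exact: finmap.fset_uniq.
by apply: eq_bigr => e _; rewrite transportM2.
Qed.

Lemma new_meval m : meval new_p new_s new_t m = transport (f (lmono L m)).
Proof.
case: m => [[l v] l']; elim: l => [|e l IH]; last first.
  rewrite -[LHS]/(amul (new_s e) (meval new_p new_s new_t (l, v, l'))) IH.
  by rewrite transportM2 //; [exact: bisection_s|exact: bisection_lmono].
elim: l' => [//|e l' IH].
rewrite -[LHS]/(amul (meval new_p new_s new_t ([::], v, l')) (new_t e)) IH.
by rewrite transportM2 //; [exact: bisection_lmono|exact: bisection_t].
Qed.

Lemma new_star (star : A -> A) : {morph star : a b / a + b} ->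
  (forall m, star (meval p s t m) = meval p s t (mflip m)) ->
  forall m, star (meval new_p new_s new_t m) =
    meval new_p new_s new_t (mflip m).
Proof.
move=> sD sm m; rewrite !new_meval -(transport_star rfF nsF conjRK fam sD sm).
by rewrite -(di_star fg) star_lmono.
Qed.

End Target.

End Transfer.

(** * The two constructions are mutually inverse *)

Section Inverse.
Variables (E F : digraph).
Hypotheses (rfE : row_finite E) (nsE : no_sources E).
Hypotheses (rfF : row_finite F) (nsF : no_sources F).
Variables (R : idomainType) (conjR : {rmorphism R -> R}).
Hypothesis conjRK : involutive conjR.
Variables (L : leavitt_algebra conjR E) (M : leavitt_algebra conjR F).
Variables (f : L -> M) (g : M -> L).
Hypothesis fg : diag_iso f g.
Let gf : diag_iso g f := diag_iso_sym fg.
Variables (S : comPzRingType) (A B : algebra S).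
Variables (p : vert E -> A) (s t : edge E -> A).
Hypothesis famA : leavitt_family p s t.
Variables (q : vert F -> B) (u w : edge F -> B).

(** At a point of a bisection n n^* n = n reads c (conj c) c = c. *)
Lemma unimodular (n : M) (r : R * monomial F) :
  bisection rfF n -> amul (amul n (la_star n)) n = n ->
  r \in normal_list rfF nsF n -> conjR r.1 * r.1 = 1.
Proof.
move=> bn nnn rl; have [_ rn] := bn; have [_ rn'] :=
  bisection_star nsF conjRK bn.
have [N [[_ /(_ _ rl)[r0 _ [x [k [y c]]]]] _]] := normal_listP rfF nsF n.
have nr : coef rfF n x k y = r.1 := normal_list_coef rl c.
have nz : coef rfF n x k y != 0 by rewrite nr.
have := congr1 (fun a => coef rfF a x k y) nnn; rewrite /=.
rewrite -(amulA (amulP M)) (coef_mul1 nsF _ _ _ rn nz) subrr.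
have nz' : coef rfF (la_star n) y (- k) x != 0.
  by rewrite coef_star // opprK conj_eq0.
rewrite (coef_mul1 nsF _ _ _ rn' nz') coef_star // sub0r opprK nr.
by rewrite -[RHS]mulr1 => /(mulfI r0).
Qed.

(** The ring isomorphism g need not be linear. But c times a monomial is the
    monomial times the diagonal element c p_v, and multiplication by a diagonal
    element can only shrink a support; as c is invertible, this applies in both
    directions. *)
Lemma supp_scale (c : R) m x k y : conjR c * c = 1 ->
  (coef rfE (g (c *: lmono M m)) x k y != 0) =
  (coef rfE (g (lmono M m)) x k y != 0).
Proof.
move=> cc; pose v := path_range m.2 m.1.2.
have lp : amul (lmono M m) (la_p M v) = lmono M m by rewrite meval_p eqxx.
have dg d : la_diag L (g (d *: la_p M v)).
  by apply: (di_diag gf); apply: diag_scale; exact: diag_p.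
have sc d a : amul a (d *: la_p M v) = d *: amul a (la_p M v).
  by rewrite (amulZr (amulP M)).
apply/idP/idP => [|h].
  rewrite -{1}lp -sc (di_M gf); apply: mul_diag_supp => //; exact: dg.
apply: (mul_diag_supp nsE (dg (conjR c))).
rewrite -(di_M gf) sc (amulZl (amulP M)) lp scalerA cc scale1r.
exact: h.
Qed.

(** A common range of the two monomials would be the range of two germs of n,
    which then coincide, and a germ lies in one monomial of the normal form. *)
Lemma monomials_orth (n : M) (r r' : R * monomial F) : bisection rfF n ->
  r \in normal_list rfF nsF n -> r' \in normal_list rfF nsF n -> r != r' ->
  amul (lmono M (mflip r.2)) (lmono M r'.2) = 0.
Proof.
move=> [_ rn] rl rl' nrr; apply: (coef_inj (rfE := rfF)) => //.
apply/funext => x; apply/funext => k; apply/funext => z; rewrite coef0 //.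
apply/eqP; apply: contrapT => /negP /(coef_mul_neq0 nsF)[l [y []]].
rewrite !coef_meval msupp_flip; case c : msupp; last by rewrite eqxx.
case c' : msupp; last by rewrite eqxx.
move=> _ _; case/negP: nrr; apply/eqP.
have [N [[uN hN] _]] := normal_listP rfF nsF n.
have [r0 rN _] := hN _ rl; have [r0' rN' _] := hN _ rl'.
have nr := normal_list_coef rl c; have nr' := normal_list_coef rl' c'.
have nz : coef rfF n y (- l) x != 0 by rewrite nr.
have nz' : coef rfF n y (k - l) z != 0 by rewrite nr'.
have [xz lk] := rn _ _ _ _ _ nz nz'.
apply: (uniq_map_inj uN rl rl'); apply: (msupp_inj _ c); first by rewrite rN.
by rewrite lk xz.
Qed.

(** Write n as a sum of scalar multiples of monomials m. The images g(m) are
    bisections with disjoint supports, and the scalars do not affect them, so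
    both sides are the sum of the transports of the g(m). *)
Lemma inverse_transport (h : B -> A) :
  {morph h : a b / a + b} -> {morph h : a b / amul a b} ->
  (forall v, h (q v) = new_p rfE nsE g p s t v) ->
  (forall e, h (u e) = new_s rfE nsE g p s t e) ->
  (forall e, h (w e) = new_t rfE nsE g p s t e) ->
  forall n : M, bisection rfF n -> amul (amul n (la_star n)) n = n ->
  h (transport rfF nsF q u w n) = transport rfE nsE p s t (g n).
Proof.
move=> hD hM hq hu hw n bn nnn.
have h0 : h 0 = 0 by apply: (@addrI _ (h 0)); rewrite -hD !addr0.
have hev m : h (meval q u w m) = transport rfE nsE p s t (g (lmono M m)).
  rewrite -(new_meval rfE nsE conjRK gf famA).
  have <- : h \o q = new_p rfE nsE g p s t by apply/funext.
  have <- : h \o u = new_s rfE nsE g p s t by apply/funext.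
  have <- : h \o w = new_t rfE nsE g p s t by apply/funext.
  case: m => [[l v] l']; elim: l => [|e l IH]; last first.
    by rewrite -[meval q u w _]/(amul (u e) (meval q u w (l, v, l'))) hM IH.
  elim: l' => [//|e l' IH].
  by rewrite -[meval q u w _]/(amul (meval q u w ([::], v, l')) (w e)) hM IH.
rewrite {1}/transport (big_morph h hD h0).
have [N [[uN hN] {2}->]] := normal_listP rfF nsF n.
rewrite /leval /eval (di_sum gf) transport_sum //; last 2 first.
- exact: map_uniq uN.
- move=> r r' x k y rl rl' nrr.
  have cc := unimodular bn nnn rl; have cc' := unimodular bn nnn rl'.
  rewrite supp_scale // => nz; apply/eqP; apply: contrapT => /negP.
  rewrite supp_scale // => nz'.
  have [_ rb] : bisection rfE (g (lmono M (mflip r.2))).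
    exact: (bisection_lmono rfE nsE conjRK gf).
  have nzf : coef rfE (g (lmono M (mflip r.2))) y (- k) x != 0.
    by rewrite -star_lmono (di_star gf) coef_star // opprK conj_eq0.
  have := coef_mul1 nsE (g (lmono M r'.2)) 0 y rb nzf.
  rewrite -(di_M gf) (monomials_orth bn rl rl' nrr) (di0 gf) coef0 //.
  rewrite sub0r opprK => /esym/eqP; rewrite mulf_eq0.
  by rewrite (negbTE nzf) (negbTE nz').
rewrite big_seq [RHS]big_seq; apply: eq_bigr => r rl.
rewrite hev; apply/esym/transport_ext => // x k y.
exact: supp_scale (unimodular bn nnn rl).
Qed.

Lemma inverse_generators (h : B -> A) :
  {morph h : a b / a + b} -> {morph h : a b / amul a b} ->
  (forall v, h (q v) = new_p rfE nsE g p s t v) ->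
  (forall e, h (u e) = new_s rfE nsE g p s t e) ->
  (forall e, h (w e) = new_t rfE nsE g p s t e) ->
  [/\ forall v, h (new_p rfF nsF f q u w v) = p v,
      forall e, h (new_s rfF nsF f q u w e) = s e &
      forall e, h (new_t rfF nsF f q u w e) = t e].
Proof.
move=> hD hM hq hu hw; have fmL := la_family L.
have key := inverse_transport hD hM hq hu hw.
split=> [v|e|e].
- rewrite key; first by rewrite (di_K fg) -lmono_p transport_meval.
    exact: bisection_p fg v.
  by rewrite -(di_star fg) -!(di_M fg) star_p !(lf_idem fmL).
- rewrite key; first by rewrite (di_K fg) -lmono_s transport_meval //;
  exact: (lf_ss famA).
    exact: bisection_s fg e.
  rewrite -(di_star fg) -!(di_M fg) star_s -(amulA (amulP L)).
  by rewrite (lf_ck1 fmL) eqxx (lf_ss fmL).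
- rewrite key; first by rewrite (di_K fg) -lmono_t transport_meval //;
  exact: (lf_st famA).
    exact: bisection_t fg e.
  by rewrite -(di_star fg) -!(di_M fg) star_t (lf_ck1 fmL) eqxx (lf_st fmL).
Qed.

End Inverse.

(** * Extreme points and sums of projections *)

Section CStarNorm.
Variables (K : realType) (A : cstar_algebra K).
Implicit Types x y z a b e q : A.
Local Notation mulA := (amulA (cmulP A)).
Local Notation mulDl := (amulDl (cmulP A)).
Local Notation mulDr := (amulDr (cmulP A)).
Local Notation mulZl := (amulZl (cmulP A)).
Local Notation mulZr := (amulZr (cmulP A)).

(** The norm takes its values in the non-negative elements of K[i]; its real
    part is the norm as an element of the ordered field K. *)
Definition nrm x : K := complex.Re `|x|.

Lemma nrmE x : (nrm x)%:C%C = `|x|.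
Proof. by apply: RRe_real; exact: normr_real. Qed.

Lemma nrm_ge0 x : 0 <= nrm x.
Proof. by rewrite -lecR nrmE; exact: normr_ge0. Qed.

Lemma nrmD x y : nrm (x + y) <= nrm x + nrm y.
Proof. by rewrite -lecR rmorphD /= !nrmE ler_normD. Qed.

Lemma nrmN x : nrm (- x) = nrm x.
Proof. by rewrite /nrm normrN. Qed.

Lemma nrmM x y : nrm (cmul x y) <= nrm x * nrm y.
Proof. by rewrite -lecR rmorphM /= !nrmE cnormM. Qed.

Lemma nrm_nat n x : nrm (n%:R *: x) = n%:R * nrm x.
Proof.
apply: (@complexI K); rewrite rmorphM /= rmorph_nat !nrmE.
by rewrite normrZ normr_nat.
Qed.

Lemma nrm_star x : nrm (cmul (cstar x) x) = nrm x ^+ 2.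
Proof. by apply: (@complexI K); rewrite rmorphXn /= !nrmE cnorm_star. Qed.

Lemma nrm_eq0 x : nrm x = 0 -> x = 0.
Proof. by move=> h; apply/eqP; rewrite -normr_eq0 -nrmE h. Qed.

Lemma nrm_sum I (r : seq I) (G : I -> A) :
  nrm (\sum_(i <- r) G i) <= \sum_(i <- r) nrm (G i).
Proof.
elim: r => [|i r IH]; first by rewrite !big_nil /nrm normr0.
by rewrite !big_cons; apply: le_trans (nrmD _ _) _; rewrite lerD2l.
Qed.

Section Extreme.
Variables (e a : A).
Hypotheses (ee : cmul e e = e) (ea : cmul e a = a) (ae : cmul a e = a).

Let b := cmul a a.
Let c := cmul b a.

(** The image of a polynomial of degree at most 3, given by its coefficients,
    under the substitution that sends 1 to e and the variable to a. *)
Definition cubic (x : K[i] * K[i] * K[i] * K[i]) : A :=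
  x.1.1.1 *: e + x.1.1.2 *: a + x.1.2 *: b + x.2 *: c.

Lemma cubicD k0 k1 k2 k3 j0 j1 j2 j3 :
  cubic (k0, k1, k2, k3) + cubic (j0, j1, j2, j3) =
  cubic (k0 + j0, k1 + j1, k2 + j2, k3 + j3).
Proof.
rewrite /cubic /= !scalerDl; rewrite [LHS]addrACA; congr (_ + _).
by rewrite [LHS]addrACA; congr (_ + _); rewrite [LHS]addrACA.
Qed.

Lemma cubicZ k k0 k1 k2 k3 : k *: cubic (k0, k1, k2, k3) =
  cubic (k * k0, k * k1, k * k2, k * k3).
Proof. by rewrite /cubic /= !scalerDr !scalerA. Qed.

Lemma cubicM k0 k1 j0 j1 j2 :
  cmul (cubic (k0, k1, 0, 0)) (cubic (j0, j1, j2, 0)) =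
  cubic (k0 * j0, k0 * j1 + k1 * j0, k0 * j2 + k1 * j1, k1 * j2).
Proof.
have eb : cmul e b = b by rewrite /b mulA ea.
have ab : cmul a b = c by rewrite /c /b mulA.
have e1 : cmul e (cubic (j0, j1, j2, 0)) = cubic (j0, j1, j2, 0).
  by rewrite /cubic /= !scale0r !addr0 !mulDr !mulZr ee ea eb.
have a1 : cmul a (cubic (j0, j1, j2, 0)) = cubic (0, j0, j1, j2).
  by rewrite /cubic /= !scale0r !addr0 add0r !mulDr !mulZr ae ab.
have -> : cubic (k0, k1, 0, 0) = k0 *: e + k1 *: a.
  by rewrite /cubic /= !scale0r !addr0.
rewrite mulDl !mulZl e1 a1 !cubicZ cubicD.
by rewrite !mulr0 addr0 add0r.
Qed.

Lemma cubicM3 k0 k1 j0 j1 l0 l1 :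
  cmul (cubic (k0, k1, 0, 0))
    (cmul (cubic (j0, j1, 0, 0)) (cubic (l0, l1, 0, 0))) =
  cubic (k0 * (j0 * l0), k0 * (j0 * l1 + j1 * l0) + k1 * (j0 * l0),
         k0 * (j1 * l1) + k1 * (j0 * l1 + j1 * l0), k1 * (j1 * l1)).
Proof. by rewrite cubicM !mulr0 add0r cubicM. Qed.

Lemma cubic_ea (k : K[i]) : cubic (1, k, 0, 0) = e + k *: a.
Proof. by rewrite /cubic /= !scale0r !addr0 scale1r. Qed.

Hypotheses (h1 : nrm (e + a) <= 1) (h2 : nrm (e - a) <= 1).

Let u := cubic (1, 1, 0, 0).
Let v := cubic (1, -1, 0, 0).

Lemma nrm_triple x y z : nrm x <= 1 -> nrm y <= 1 -> nrm z <= 1 ->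
  nrm (cmul x (cmul y z)) <= 1.
Proof.
move=> hx hy hz; apply: le_trans (nrmM _ _) _.
rewrite mulr_ile1 ?nrm_ge0 //; apply: le_trans (nrmM _ _) _.
by rewrite mulr_ile1 ?nrm_ge0.
Qed.

Lemma nrm_u : nrm u <= 1.
Proof. by rewrite /u cubic_ea scale1r. Qed.

Lemma nrm_v : nrm v <= 1.
Proof. by rewrite /v cubic_ea scaleN1r. Qed.

(** First (1 + a) - (1 - a) = 2a gives |a| <= 1, and then
    (1 + a)^3 - (1 - a)^3 = 6a + 2a^3 gives 6|a| <= 2 + 2|a|. *)
Lemma half_bound : 2 * nrm a <= 1.
Proof.
have Ha : 2%:R *: a = u - v.
  rewrite -scaleN1r /u /v cubicZ cubicD /cubic /=.
  have -> : 1 + -1 * 1 = 0 :> K[i] by ring.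
  have -> : 1 + -1 * -1 = 2 :> K[i] by ring.
  by rewrite !mulr0 !addr0 !scale0r add0r !addr0.
have a1 : nrm a <= 1.
  have := nrm_nat 2 a; rewrite Ha => e2.
  have := nrmD u (- v); rewrite nrmN e2.
  move: nrm_u nrm_v; lra.
have Hc : 6%:R *: a = cmul u (cmul u u) - cmul v (cmul v v) - 2%:R *: c.
  rewrite -[- cmul v _]scaleN1r /u /v !cubicM3 cubicZ cubicD.
  have -> : - (2%:R *: c) = cubic (0, 0, 0, -2).
    by rewrite /cubic /= !scale0r !add0r scaleNr.
  have -> : 6%:R *: a = cubic (0, 6, 0, 0).
    by rewrite /cubic /= !scale0r !add0r !addr0.
  rewrite cubicD; congr (cubic (_, _, _, _)); ring.
have c1 : nrm c <= nrm a.
  apply: le_trans (nrmM _ _) _; rewrite -[leRHS]mul1r.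
  apply: ler_wpM2r; first exact: nrm_ge0.
  by apply: le_trans (nrmM _ _) _; rewrite mulr_ile1 ?nrm_ge0.
have := nrm_nat 6 a; rewrite Hc => e6.
have := nrmD (cmul u (cmul u u) - cmul v (cmul v v)) (- (2%:R *: c)).
rewrite e6 nrmN nrm_nat => h.
have := nrmD (cmul u (cmul u u)) (- cmul v (cmul v v)); rewrite nrmN => h'.
have := nrm_triple nrm_u nrm_u nrm_u; have := nrm_triple nrm_v nrm_v nrm_v.
move: h h' c1; lra.
Qed.

(** The polynomial g(x) = (3x - x^3)/2 satisfies
    1 + g(x) = ((1 + x)^3 + 3 (1 - x) (1 + x)^2)/4, so it preserves the
    condition that |1 + x| and |1 - x| are at most 1, while it expands small
    elements. *)
Definition expand : A := cubic (0, 3%:R / 2%:R, 0, - (1 / 2%:R)).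

Lemma two_neq0 : (2%:R : K[i]) != 0.
Proof. by rewrite pnatr_eq0. Qed.

Lemma four_halves : 4%:R * (3%:R / 2%:R) = 6%:R :> K[i] /\
  4%:R * (1 / 2%:R) = 2%:R :> K[i].
Proof.
have := mulfV two_neq0; move: (2%:R^-1 : K[i]) => k h; split.
  by transitivity (6%:R * (2%:R * k)); [ring|rewrite h mulr1].
by transitivity (2%:R * (2%:R * k)); [ring|rewrite h mulr1].
Qed.

Lemma expand_unit : cmul e expand = expand /\ cmul expand e = expand.
Proof.
have ec : cmul e c = c by rewrite /c /b !mulA ea.
have ce : cmul c e = c by rewrite /c -mulA ae.
rewrite /expand /cubic /= !scale0r !add0r !addr0 mulDr mulDl !mulZr !mulZl.
by rewrite ea ae ec ce.
Qed.

Lemma nrm_expand_p : nrm (e + expand) <= 1.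
Proof.
have h : 4%:R *: (e + expand) =
    cmul u (cmul u u) + 3%:R *: cmul v (cmul u u).
  rewrite /u /v !cubicM3 cubicZ cubicD.
  have -> : e + expand = cubic (1, 3%:R / 2%:R, 0, - (1 / 2%:R)).
    by rewrite /expand /cubic /= !scale0r add0r !addr0 scale1r addrA.
  rewrite cubicZ; have [q1 q2] := four_halves.
  by congr (cubic (_, _, _, _)); rewrite ?mulrN ?q1 ?q2; ring.
have := nrmD (cmul u (cmul u u)) (3%:R *: cmul v (cmul u u)).
rewrite -h !nrm_nat.
have := nrm_triple nrm_u nrm_u nrm_u; have := nrm_triple nrm_v nrm_u nrm_u.
lra.
Qed.

Lemma nrm_expand_m : nrm (e - expand) <= 1.
Proof.
have h : 4%:R *: (e - expand) =
    cmul v (cmul v v) + 3%:R *: cmul u (cmul v v).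
  rewrite /u /v !cubicM3 cubicZ cubicD.
  have -> : e - expand = cubic (1, - (3%:R / 2%:R), 0, 1 / 2%:R).
    rewrite /expand /cubic /= !scale0r add0r !addr0 scale1r opprD addrA.
    by rewrite -!scaleNr opprK.
  rewrite cubicZ; have [q1 q2] := four_halves.
  by congr (cubic (_, _, _, _)); rewrite ?mulrN ?q1 ?q2; ring.
have := nrmD (cmul v (cmul v v)) (3%:R *: cmul u (cmul v v)).
rewrite -h !nrm_nat.
have := nrm_triple nrm_v nrm_v nrm_v; have := nrm_triple nrm_u nrm_v nrm_v.
lra.
Qed.

Lemma nrm_expand : 5 * nrm a <= 4 * nrm expand.
Proof.
have h : 3%:R *: a = 2%:R *: expand + c.
  rewrite /expand /cubic /= !scale0r add0r addr0 scalerDr !scalerA.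
  rewrite mulrCA mulfV ?two_neq0 // mulr1 mulrN mulrCA mulfV ?two_neq0 //.
  by rewrite mulr1 scaleN1r addrNK.
have := nrmD (2%:R *: expand) c; rewrite -h !nrm_nat.
have hb := half_bound; have a0 := nrm_ge0 a.
have c1 : 4 * nrm c <= nrm a.
  have := nrmM b a; have := nrmM a a; rewrite -/b -/c => hb1 hc1.
  have : nrm b * nrm a <= (nrm a * nrm a) * nrm a by rewrite ler_wpM2r.
  have : nrm a * nrm a * nrm a <= 2^-1 * 2^-1 * nrm a.
    by rewrite ler_wpM2r // ler_pM //; lra.
  lra.
lra.
Qed.

End Extreme.

(** The iterates of [expand] stay in the ball of radius 1/2 and each of them is
    at least 5/4 times as large as the one before, which forces a = 0. By
    Bernoulli the linear lower bound 1 + n/4 for the growth is enough. *)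
Lemma unit_extreme e a : cmul e e = e -> cmul e a = a -> cmul a e = a ->
  nrm (e + a) <= 1 -> nrm (e - a) <= 1 -> a = 0.
Proof.
move=> ee ea ae h1 h2; apply: nrm_eq0.
have key n : forall a, cmul e a = a -> cmul a e = a ->
    nrm (e + a) <= 1 -> nrm (e - a) <= 1 -> (4 + n%:R) * nrm a <= 4.
  elim: n => [|n IH] {}a {}ea {}ae {}h1 {}h2.
    have := half_bound ee ea ae h1 h2; have := nrm_ge0 a; lra.
  have [x1 x2] := expand_unit ea ae.
  have := IH _ x1 x2 (nrm_expand_p ee ea ae h1 h2)
    (nrm_expand_m ee ea ae h1 h2).
  have h := nrm_expand ee ea ae h1 h2; have a0 := nrm_ge0 a.
  have n0 : 0 <= n%:R :> K by [].
  rewrite -[n.+1]addn1 natrD; nra.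
apply/eqP; rewrite eq_le nrm_ge0 andbT leNgt; apply/negP => a0.
have hb : 0 <= 4 / nrm a by rewrite divr_ge0 // ltW.
have := archi_boundP hb; rewrite ltr_pdivrMr // => h.
have := key (Num.Def.archi_bound (4 / nrm a)) _ ea ae h1 h2.
nra.
Qed.

End CStarNorm.

Section Projections.
Variables (K : realType) (A : cstar_algebra K).
Implicit Types x y z a b e q : A.
Local Notation mulA := (amulA (cmulP A)).
Local Notation mulDl := (amulDl (cmulP A)).
Local Notation mulDr := (amulDr (cmulP A)).
Local Notation CA := (Algebra (cmulP A)).

Lemma cmul0 x : cmul x 0 = 0.
Proof. exact: (amul0 (A := CA)). Qed.

Lemma cmul0r x : cmul 0 x = 0.
Proof. exact: (amul0r (A := CA)). Qed.

Lemma cmul_suml I (r : seq I) (G : I -> A) x :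
  cmul (\sum_(i <- r) G i) x = \sum_(i <- r) cmul (G i) x.
Proof. exact: (amul_suml (A := CA)). Qed.

Lemma cmul_sumr I (r : seq I) (G : I -> A) x :
  cmul x (\sum_(i <- r) G i) = \sum_(i <- r) cmul x (G i).
Proof. exact: (amul_sumr (A := CA)). Qed.

Lemma cmulBl x y z : cmul (x - y) z = cmul x z - cmul y z.
Proof. by rewrite mulDl -scaleN1r (amulZl (cmulP A)) scaleN1r. Qed.

Lemma cmulBr x y z : cmul z (x - y) = cmul z x - cmul z y.
Proof. by rewrite mulDr -scaleN1r (amulZr (cmulP A)) scaleN1r. Qed.

Lemma cstarN x : cstar (- x) = - cstar x.
Proof. by rewrite -scaleN1r cstarZ rmorphN rmorph1 scaleN1r. Qed.

Lemma cstar_eq0 x : cmul (cstar x) x = 0 -> x = 0.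
Proof.
move=> h; apply: nrm_eq0; apply/eqP; rewrite -sqrf_eq0 -nrm_star h.
by rewrite /nrm normr0.
Qed.

Lemma sqr_le (k l : K) : 0 <= k -> k ^+ 2 <= l * k -> 0 <= l -> k <= l.
Proof.
move=> k0; rewrite expr2; have [->//|kn] := eqVneq k 0.
by rewrite ler_pM2r // lt_neqAle eq_sym kn.
Qed.

Lemma nrm_proj q : projection q -> nrm q <= 1.
Proof.
move=> [qq sq]; apply: sqr_le => //; first exact: nrm_ge0.
by rewrite -nrm_star sq qq mul1r.
Qed.

(** Multiplication by 1 - q is contractive: (1 - q) y has the same inner product
    with itself as with y. The element 1 itself need not exist in A. *)
Lemma nrm_compl q y : projection q -> nrm (y - cmul q y) <= nrm y.
Proof.
move=> [qq sq]; apply: sqr_le; [exact: nrm_ge0| |exact: nrm_ge0].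
have sy : nrm (cstar y) = nrm y.
  suff le x : nrm x <= nrm (cstar x).
    by apply/eqP; rewrite eq_le le andbT -[X in _ <= nrm X](cstarK y) le.
  apply: sqr_le; [exact: nrm_ge0| |exact: nrm_ge0].
  by rewrite -nrm_star nrmM.
rewrite -nrm_star -[in X in _ <= X * _]sy.
suff -> : cmul (cstar (y - cmul q y)) (y - cmul q y) =
    cmul (cstar y) (y - cmul q y) by exact: nrmM.
rewrite cstarD cstarN cstarM sq cmulBl -[RHS]subr0; congr (_ - _).
by rewrite cmulBr mulA -[in X in _ - cmul X y]mulA qq subrr.
Qed.

Section Pair.
Variables (q r : A).
Hypotheses (pq : projection q) (pr : projection r).
Let z := cmul q (cmul r q).

Lemma compress_units : cmul q z = z /\ cmul z q = z.
Proof. by have [qq _] := pq; rewrite /z mulA qq -!mulA qq. Qed.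

(** Here q - q r q = q (1 - r) q. *)
Lemma nrm_compress : nrm (q - z) <= 1.
Proof.
have [qq _] := pq.
have -> : q - z = cmul q (q - cmul r q) by rewrite cmulBr qq.
apply: le_trans (nrmM _ _) _; rewrite mulr_ile1 ?nrm_ge0 ?(nrm_proj pq) //.
by apply: le_trans (nrm_compl _ pr) _; exact: nrm_proj.
Qed.

Lemma compress_eq0 : z = 0 -> cmul r q = 0.
Proof.
have [_ sq] := pq; have [rr sr] := pr; move=> h; apply: cstar_eq0.
by rewrite cstarM sq sr mulA -[cmul (cmul q r) r]mulA rr -mulA.
Qed.

End Pair.

(** In the corner of q = G i the elements z_k = q (G k) q satisfy
    |q - z_k| <= 1 for each k, and |q + sum z_k| <= 1, where k runs over the
    indices other than i. If M is their number, averaging these bounds gives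
    |q + z_j / M| <= 1 and |q - z_j / M| <= 1, so z_j = 0. *)
Lemma sum_proj_orth (I : eqType) (r : seq I) (G : I -> A) i j :
  uniq r -> (forall k, projection (G k)) -> projection (\sum_(k <- r) G k) ->
  i \in r -> j \in r -> i != j -> cmul (G j) (G i) = 0.
Proof.
move=> ur pG pS ir jr nij; apply: compress_eq0 => //.
have [qq sq] := pG i.
pose z k := cmul (G i) (cmul (G k) (G i)).
pose rest := rem j (rem i r); pose M := (size rest).+1.
have jr' : j \in rem i r by rewrite mem_rem_uniq // inE eq_sym nij.
(* The summand k = i of q (sum of the G k) q is q itself. *)
have zS : G i + z j + \sum_(k <- rest) z k =
    cmul (G i) (cmul (\sum_(k <- r) G k) (G i)).
  rewrite cmul_suml cmul_sumr.
  rewrite [RHS](big_rem i) //= !qq -addrA; congr (_ + _).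
  by rewrite [RHS](big_rem j).
have nS : nrm (G i + z j + \sum_(k <- rest) z k) <= 1.
  rewrite zS; apply: le_trans (nrmM _ _) _.
  rewrite mulr_ile1 ?nrm_ge0 ?(nrm_proj (pG i)) //;
    apply: le_trans (nrmM _ _) _.
  by rewrite mulr_ile1 ?nrm_ge0 ?nrm_proj.
have sumG : \sum_(k <- rest) G i = (size rest)%:R *: G i.
  by rewrite big_const_seq count_predT iter_addr_0 scaler_nat.
have nrest : nrm (\sum_(k <- rest) (G i - z k)) <= (size rest)%:R.
  apply: le_trans (nrm_sum _ _) _.
  apply: (@le_trans _ _ (\sum_(k <- rest) 1)).
    by apply: ler_sum => k _; exact: nrm_compress.
  by rewrite big_const_seq count_predT iter_addr_0.
have M0 : (M%:R : K[i]) != 0 by rewrite pnatr_eq0.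
have MK : 0 < M%:R :> K by rewrite ltr0n.
have [z1 z2] := compress_units (G j) (pG i).
(* The factor 1 / M makes both q + a and q - a averages of contractions. *)
pose a := M%:R^-1 *: z j.
have Ma : M%:R *: a = z j by rewrite scalerA mulfV // scale1r.
suff a0 : a = 0 by rewrite -[cmul _ _]Ma a0 scaler0.
have divM x : nrm (M%:R *: x) <= M%:R -> nrm x <= 1.
  by rewrite nrm_nat -[leRHS]mulr1 ler_pM2l.
have MS : M%:R = 1 + (size rest)%:R :> K by rewrite -[M]add1n natrD.
have MS' : M%:R = 1 + (size rest)%:R :> K[i] by rewrite -[M]add1n natrD.
apply: (@unit_extreme _ _ (G i)) => //.
- by rewrite (amulZr (cmulP A)) z1.
- by rewrite (amulZl (cmulP A)) z2.
- apply: divM; rewrite scalerDr Ma MS' scalerDl scale1r -sumG.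
  have -> : G i + \sum_(k <- rest) G i + z j =
      (G i + z j + \sum_(k <- rest) z k) + \sum_(k <- rest) (G i - z k).
    by rewrite sumrB addrACA subrr addr0 [RHS]addrAC.
  apply: le_trans (nrmD _ _) _; rewrite MS lerD //.
- apply: divM; rewrite scalerBr Ma MS' scalerDl scale1r addrAC.
  apply: le_trans (nrmD _ _) _; rewrite MS lerD //; first exact: nrm_compress.
  by rewrite nrm_nat -[leRHS]mulr1 ler_wpM2l // nrm_proj.
Qed.

End Projections.

(** * Cuntz-Krieger families *)

Section CuntzKrieger.
Variables (K : realType) (A : cstar_algebra K) (E : digraph).
Hypothesis rfE : row_finite E.
Variables (P : vert E -> A) (T : edge E -> A).
Local Notation mulA := (amulA (cmulP A)).
Local Notation CA := (Algebra (cmulP A)).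

(** The point that is not formal is s_f^* s_e = 0 for distinct edges e and f with
    the same range. It holds because their range projections are summands of a
    finite sum of projections that is itself a projection. *)
Lemma ck_leavitt : ck_family P T ->
  @leavitt_family _ E CA P T (fun e => cstar (T e)).
Proof.
move=> ck; pose q e := cmul (T e) (cstar (T e)).
have piso e : cmul (q e) (T e) = T e by exact: (ck_piso ck).
have piso' e : cmul (cstar (T e)) (q e) = cstar (T e).
  by rewrite -[in RHS](piso e) cstarM cstarM cstarK.
have pq e : projection (q e).
  by split; [rewrite {2}/q mulA piso|rewrite /q cstarM cstarK].
have sumP v : P v = \sum_(e <- edges_at v) q e.
  by rewrite (ck_rng ck) fsbig_finite //; exact: rfE.
have orth e f : rng e = rng f -> e != f -> cmul (q f) (q e) = 0.
  move=> ref nef; apply: (@sum_proj_orth _ _ _ (edges_at (rng e)) q) => //.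
  - exact: finmap.fset_uniq.
  - by rewrite -sumP; exact: (ck_proj ck).
  - by rewrite mem_edges_at.
  - by rewrite mem_edges_at // ref.
have cross e f : rng e = rng f -> e != f -> cmul (cstar (T f)) (T e) = 0.
  move=> ref nef; rewrite -piso' -(piso e) mulA -[cmul (cmul _ _) (q e)]mulA.
  by rewrite orth // cmul0 cmul0r.
have rs e : cmul (P (rng e)) (T e) = T e.
  rewrite sumP cmul_suml (bigD1_seq e) ?mem_edges_at ?finmap.fset_uniq //=.
  rewrite piso big_seq_cond big1 ?addr0 //.
  move=> f /andP[]; rewrite mem_edges_at // => /eqP rf nfe.
  rewrite /q -mulA cross ?cmul0 //.
  by rewrite eq_sym.
have pstar v : cstar (P v) = P v by have [_] := ck_proj ck v.
have rt e : cmul (cstar (T e)) (P (rng e)) = cstar (T e).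
  by rewrite -[in RHS](rs e) cstarM pstar.
split => /=.
- by move=> v; have [] := ck_proj ck v.
- exact: (ck_orth ck).
- exact: rs.
- by move=> e; rewrite -(ck_src ck) mulA piso.
- by move=> e; rewrite -(ck_src ck) -mulA piso'.
- exact: rt.
- move=> e f; case: eqP => [->|/eqP nef]; first exact: (ck_src ck).
  have [ref|nr] := eqVneq (rng e) (rng f); first by apply: cross;
    rewrite // eq_sym.
  rewrite -rt -(rs f) mulA -[cmul (cmul _ _) (P (rng f))]mulA (ck_orth ck) //.
  by rewrite cmul0 cmul0r.
- exact: (ck_rng ck).
Qed.

Lemma leavitt_ck : @leavitt_family _ E CA P T (fun e => cstar (T e)) ->
  (forall v, cstar (P v) = P v) -> ck_family P T.
Proof.
move=> fam Ps; split.
- by move=> v; split; [exact: (lf_idem fam)|exact: Ps].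
- exact: (lf_orth fam).
- move=> e; rewrite /partial_isometry -mulA.
  have /= -> := lf_ck1 fam e e; rewrite eqxx; exact: (lf_ss fam).
- by move=> e; have /= -> := lf_ck1 fam e e; rewrite eqxx.
- exact: (lf_ck2 fam).
Qed.

End CuntzKrieger.

(** * The isomorphisms *)

Section Star.
Variables (S : comPzRingType) (A : algebra S) (E : digraph).
Variables (p : vert E -> A) (s t : edge E -> A) (star : A -> A).
Local Notation mulA := (amulA (amulP A)).

Lemma meval_star : {morph star : a b / amul a b >-> amul b a} ->
  (forall v, star (p v) = p v) -> (forall e, star (s e) = t e) ->
  (forall e, star (t e) = s e) ->
  forall m, star (meval p s t m) = meval p s t (mflip m).
Proof.
move=> sM sp ss st [[l v] l']; rewrite /meval /=.
pose U := foldr (fun e a => amul (s e) a); pose V :=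
  foldr (fun e a => amul a (t e)).
have UV l1 l2 a : V (U a l1) l2 = U (V a l2) l1.
  have Vs b e : V (amul (s e) b) l2 = amul (s e) (V b l2).
    by rewrite /V; elim: l2 => //= e' l2 ->; rewrite mulA.
  elim: l1 => [//|e l1 IH].
  by rewrite -[U a (e :: l1)]/(amul (s e) (U a l1)) Vs IH.
have sV l1 : star (V (p v) l1) = U (p v) l1.
  by elim: l1 => [|e l1 IH]; [exact: sp|rewrite /= sM IH st].
rewrite -/(V _ _) -/(U _ _) -[RHS]/(U (V (p v) l) l') -[RHS]UV -sV.
by elim: (l) => //= e l1 IH; rewrite sM IH ss.
Qed.

End Star.

Section Isomorphisms.
Variables (E F : digraph).
Hypotheses (rfE : row_finite E) (nsE : no_sources E).
Hypotheses (rfF : row_finite F) (nsF : no_sources F).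
Variables (R : idomainType) (conjR : {rmorphism R -> R}).
Hypothesis conjRK : involutive conjR.
Variables (L : leavitt_algebra conjR E) (M : leavitt_algebra conjR F).
Variables (f : L -> M) (g : M -> L).
Hypothesis fg : diag_iso f g.
Let gf : diag_iso g f := diag_iso_sym fg.

Lemma leavitt_iso (S : comPzRingType) (conjS : {rmorphism S -> S})
    (LS : leavitt_algebra conjS E) (MS : leavitt_algebra conjS F) :
  exists phi : LS -> MS, leavitt_algebra_star_iso phi.
Proof.
have famL := la_family LS; have famM := la_family MS.
have newL := new_family rfE rfF nsF conjRK fg famM.
have newM := new_family rfF rfE nsE conjRK gf famL.
have [phi [[phom [pp ps pt]] _]] := la_universal LS newL.
have [psi [[qhom [qp qs qt]] _]] := la_universal MS newM.
have [[pl pM] [ql qM]] := (phom, qhom).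
have add (U V : lmodType S) (h : U -> V) : linear h -> {morph h : a b / a + b}.
  by move=> hl a b; rewrite -[a]scale1r hl !scale1r.
have [ip is_ it] :=
  inverse_generators rfF nsF conjRK fg famL (add _ _ _ ql) qM qp qs qt.
have [jp js jt] :=
  inverse_generators rfE nsE conjRK gf famM (add _ _ _ pl) pM pp ps pt.
have comp (U V W : algebra S) (h : U -> V) (k : V -> W) :
    algebra_hom h -> algebra_hom k -> algebra_hom (k \o h).
  move=> [hl hM] [kl kM]; split; first by move=> c a b /=; rewrite hl kl.
  by move=> a b /=; rewrite hM kM.
have psiK : cancel phi psi.
  have [f0 [_ uf]] := la_universal LS famL.
  have e1 : f0 = id by exact: uf.
  suff e2 : f0 = psi \o phi by move=> a; rewrite -[LHS]/((psi \o phi) a) -e2 e1.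
  apply: uf; split; first exact: comp.
  by split=> x /=; rewrite ?pp ?ps ?pt.
have phiK : cancel psi phi.
  have [f0 [_ uf]] := la_universal MS famM.
  have e1 : f0 = id by exact: uf.
  suff e2 : f0 = phi \o psi by move=> a; rewrite -[LHS]/((phi \o psi) a) -e2 e1.
  apply: uf; split; first exact: comp.
  by split=> x /=; rewrite ?qp ?qs ?qt.
exists phi; split; [by exists psi|by []|].
have starZ (c : S) (a : MS) : la_star (c *: a) = conjS c *: la_star a.
  have [la ->] := eval_spans rfF nsF a.
  rewrite /leval -eval_fscale /eval !star_sum big_map scaler_sumr.
  by apply: eq_bigr => r _; rewrite !star_meval rmorphM scalerA.
have phim m : phi (lmono LS m) =
    meval (new_p rfF nsF f (la_p MS) (la_s MS) (la_t MS))
        (new_s rfF nsF f (la_p MS) (la_s MS) (la_t MS))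
        (new_t rfF nsF f (la_p MS) (la_s MS) (la_t MS)) m.
  rewrite /lmono hom_meval //; congr (meval _ _ _ m); exact/funext.
have phi_sum I (r : seq I) (G : I -> LS) :
    phi (\sum_(i <- r) G i) = \sum_(i <- r) phi (G i).
  apply: (big_morph phi (add _ _ _ pl)).
  by apply: (@addrI _ (phi 0)); rewrite -(add _ _ _ pl) !addr0.
have phiZ c a : phi (c *: a) = c *: phi a.
  have := pl c a 0; rewrite !addr0 => ->.
  have := phi_sum unit [::] (fun=> 0); rewrite !big_nil => ->.
  by rewrite addr0.
move=> a; have [la ->] := eval_spans rfE nsE a.
rewrite /leval /eval star_sum !phi_sum star_sum; apply: eq_bigr => r _.
rewrite -/(lmono LS _) star_meval !phiZ starZ !phim; congr (_ *: _); apply/esym.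
apply: (new_star rfF nsF conjRK fg famM); first exact: (@la_starD _ _ _ MS).
exact: star_lmono.
Qed.

Section CStarTarget.
Variables (K : realType) (A : cstar_algebra K).
Variables (P : vert F -> A) (T : edge F -> A).
Hypothesis ck : ck_family P T.
Let CA := Algebra (cmulP A).
Let T' : edge F -> CA := fun e => cstar (T e).

Definition cstar_p : vert E -> A := new_p (A := CA) rfF nsF f P T T'.
Definition cstar_s : edge E -> A := new_s (A := CA) rfF nsF f P T T'.

Lemma cstar_transport (a : M) : transport rfF nsF (A := CA) P T T' (la_star a) =
  cstar (transport rfF nsF (A := CA) P T T' a : A).
Proof.
apply: (transport_star rfF nsF conjRK (ck_leavitt rfF ck) (@cstarD _ A)).
apply: (@meval_star _ CA F P T T' cstar).
- exact: cstarM.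
- by move=> v; have [_] := ck_proj ck v.
- by [].
- by move=> e; exact: cstarK.
Qed.

Lemma star_cstar_s : (fun e => cstar (cstar_s e)) =
  new_t (A := CA) rfF nsF f P T T'.
Proof.
by apply/funext => e; rewrite /cstar_s /new_s -cstar_transport -(di_star fg)
  star_s.
Qed.

Lemma cstar_generators : ck_family cstar_p cstar_s.
Proof.
apply: leavitt_ck; last first.
  by move=> v; rewrite /cstar_p /new_p -cstar_transport -(di_star fg) star_p.
rewrite star_cstar_s.
exact: (new_family rfE rfF nsF conjRK fg (ck_leavitt rfF ck)).
Qed.

End CStarTarget.

End Isomorphisms.

Lemma graph_cstar_cancel (E F : digraph)
    (rfE : row_finite E) (nsE : no_sources E)
    (rfF : row_finite F) (nsF : no_sources F)
    (R : idomainType) (conjR : {rmorphism R -> R}) (conjRK : involutive conjR)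
    (L : leavitt_algebra conjR E) (M : leavitt_algebra conjR F)
    (f : L -> M) (g : M -> L) (fg : diag_iso f g)
    (K : realType) (CE : graph_cstar_algebra K E) (CF : graph_cstar_algebra K F)
    (phi : CE -> CF) (psi : CF -> CE) :
  cstar_hom phi -> cstar_hom psi ->
  (forall v, phi (gc_P CE v) = cstar_p rfF nsF f (gc_P CF) (gc_S CF) v) ->
  (forall e, phi (gc_S CE e) = cstar_s rfF nsF f (gc_P CF) (gc_S CF) e) ->
  (forall v, psi (gc_P CF v) = cstar_p rfE nsE g (gc_P CE) (gc_S CE) v) ->
  (forall e, psi (gc_S CF e) = cstar_s rfE nsE g (gc_P CE) (gc_S CE) e) ->
  cancel phi psi.
Proof.
move=> phom qhom pP pS qP qS.
have [[pl pM pst] [ql qM qst]] := (phom, qhom).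
have gf := diag_iso_sym fg.
have ckE := gc_family CE; have ckF := gc_family CF.
have qT e : psi (cstar (gc_S CF e)) =
    new_t (A := Algebra (cmulP CE)) rfE nsE g (gc_P CE) (gc_S CE)
      (fun e => cstar (gc_S CE e)) e.
  by rewrite -(star_cstar_s rfE nsE conjRK gf ckE) qst qS.
have qD : {morph psi : a b / a + b}.
  by move=> a b; rewrite -[a]scale1r ql !scale1r.
have [ip is_ _] := @inverse_generators E F rfE nsE rfF nsF R conjR conjRK L M f
  g
  fg _ (Algebra (cmulP CE)) (Algebra (cmulP CF)) _ _ _ (ck_leavitt rfE ckE)
  (gc_P CF) (gc_S CF) (fun e => cstar (gc_S CF e)) psi qD qM qP qS qT.
have [f0 [_ uf]] := gc_universal CE ckE.
have e1 : f0 = id by exact: uf.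
suff e2 : f0 = psi \o phi by move=> a; rewrite -[LHS]/((psi \o phi) a) -e2 e1.
apply: uf; split.
  split=> [c a b|a b|a] /=; first by rewrite pl ql.
    by rewrite pM qM.
  by rewrite pst qst.
by split=> x /=; rewrite ?pP ?pS; [exact: ip|exact: is_].
Qed.

Theorem corollary6p3 (E F : digraph)
    (rfE : row_finite E) (nsE : no_sources E)
    (rfF : row_finite F) (nsF : no_sources F)
    (R : idomainType) (conjR : {rmorphism R -> R}) (conjRK : involutive conjR)
    (S : comPzRingType) (conjS : {rmorphism S -> S})
    (conjSK : involutive conjS)
    (LRE : leavitt_algebra conjR E) (LRF : leavitt_algebra conjR F)
    (pi : LRE -> LRF)
    (pi_iso : leavitt_ring_star_iso pi)
    (pi_diag : pi @` la_diag LRE = la_diag LRF) :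
  (forall (LSE : leavitt_algebra conjS E) (LSF : leavitt_algebra conjS F),
     exists phi : LSE -> LSF, leavitt_algebra_star_iso phi) /\
  (forall (K : realType) (CE : graph_cstar_algebra K E)
          (CF : graph_cstar_algebra K F),
     exists psi : CE -> CF, cstar_iso psi).
Proof.
have [[g piK gK] piD piM pis] := pi_iso.
have fg : diag_iso pi g.
  split=> // d dd; first by rewrite -pi_diag; exists d.
  by move: dd; rewrite -pi_diag => -[x dx <-]; rewrite piK.
have gf := diag_iso_sym fg; split=> [LSE LSF|K CE CF].
  exact: (leavitt_iso rfE nsE rfF nsF conjRK fg).
have ckE := gc_family CE; have ckF := gc_family CF.
have [phi [[phom [pP pS]] _]] :=
  gc_universal CE (cstar_generators rfE rfF nsF conjRK fg ckF).
have [psi [[qhom [qP qS]] _]] :=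
  gc_universal CF (cstar_generators rfF rfE nsE conjRK gf ckE).
exists phi; split=> //; exists psi.
  exact: (graph_cstar_cancel conjRK fg phom qhom pP pS qP qS).
exact: (graph_cstar_cancel conjRK gf qhom phom qP qS pP pS).
Qed.
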